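(* Let $n\ge2$, and let $S_1,\dots,S_{n+1}$ be either the difference bridge or a well-defined conditional bridge (both of length $n+1$) of a random walk in $\mathbb R^2$ whose increments $X_i$ satisfy $\mathbb P(X_1\in h)=0$ for every affine line $h\subset\mathbb R^2$. Then $$\mathbb P\bigl(0\notin\operatorname{conv}(S_1,\dots,S_n)\bigr)=\sum_{k=1}^n\frac{1}{k(n-k+1)}.$$
   Context: A random walk is $W_k=X_1+\dots+X_k$ with i.i.d. increments. Its difference bridge of length $n+1$ is the sequence $S_k=W_k-\frac{k}{n+1}W_{n+1}$, $1\le k\le n+1$. Its conditional bridge of length $n+1$ is the sequence $S_1,\dots,S_{n+1}$ with $S_{n+1}=0$ whose law is that of the walk conditioned on $W_{n+1}=0$, understood as the limit, as $r\to0+$, of the conditional distributions $\mathbb P(\,\cdot\mid |W_{n+1}|\le r)$; it is well-defined if $\mathbb P(|W_{n+1}|\le r)>0$ for all $r>0$ and the limit exists, i.e. if there is a probability law $Q$ of $(S_1,\dots,S_n)$ such that $\mathbb P((W_1,\dots,W_n)\in B\mid |W_{n+1}|\le r)\to Q(B)$ as $r\to0+$ for every Borel set $B$. *)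

(* Defs.v *)
From HB Require Import structures.
From mathcomp Require Import all_boot all_order all_algebra.
From mathcomp Require Import all_classical all_reals all_analysis.

Set Implicit Arguments.
Unset Strict Implicit.
Unset Printing Implicit Defensive.

Import Order.TTheory GRing.Theory Num.Theory.
Import numFieldNormedType.Exports.

Local Open Scope classical_set_scope.
Local Open Scope ring_scope.

Definition conv_hull (R : realType) (V : lmodType R) (A : set V) : set V :=
  smallest (@convex_set R V) A.

(* The library norm on R * R is the sup norm, hence this definition. *)
Definition euclidean_norm (R : realType) (x : R * R) : R :=
  Num.sqrt (x.1 ^+ 2 + x.2 ^+ 2).

Definition affine_line (R : realType) (h : set (R * R)) : Prop :=
  exists p v : R * R, v != 0 /\ h = [set p + t *: v | t in [set: R]].

Definition mutually_independent (d d' : measure_display) (T : measurableType d)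
    (E : measurableType d') (R : realType) (P : probability T R)
    (X : nat -> {RV P >-> E}) : Prop :=
  forall (I : seq nat) (B : nat -> set E), uniq I ->
    (forall i, measurable (B i)) ->
    P (\bigcap_(i in [set` I]) (X i @^-1` B i)) =
    (\prod_(i <- I) fine (P (X i @^-1` B i)))%:E.

(* Equality of laws is only meaningful on measurable sets: the library's
   measures are functions on all subsets, with arbitrary values elsewhere. *)
Definition identically_distributed (d d' : measure_display)
    (T : measurableType d) (E : measurableType d') (R : realType)
    (P : probability T R) (X : nat -> {RV P >-> E}) : Prop :=
  forall (i j : nat) (B : set E), measurable B ->
    distribution P (X i) B = distribution P (X j) B.

Definition iid (d d' : measure_display) (T : measurableType d)
    (E : measurableType d') (R : realType) (P : probability T R)
    (X : nat -> {RV P >-> E}) : Prop :=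
  mutually_independent X /\ identically_distributed X.

(* [X i] is the (i+1)-st increment, so [walk X k] = X_1 + ... + X_k. *)
Definition walk (T : Type) (V : zmodType) (X : nat -> T -> V) (k : nat)
    (w : T) : V :=
  \sum_(i < k) X i w.

Definition difference_bridge (T : Type) (R : realType) (V : lmodType R)
    (X : nat -> T -> V) (n k : nat) (w : T) : V :=
  walk X k w - (k%:R / n.+1%:R) *: walk X n.+1 w.

Definition walk_path (T : Type) (V : zmodType) (X : nat -> T -> V) (n : nat)
    (w : T) : n.-tuple V :=
  [tuple walk X i.+1 w | i < n].

Definition cond_prob (d : measure_display) (T : measurableType d)
    (R : realType) (P : probability T R) (A C : set T) : R :=
  fine (P (A `&` C)) / fine (P C).

(* [Q] is the law of the first n points S_1, ..., S_n of the conditional bridge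
   of length n + 1, whose last point is S_(n+1) = 0. The bridge is well-defined
   iff such a [Q] exists. *)
Definition conditional_bridge_law (d : measure_display) (T : measurableType d)
    (R : realType) (P : probability T R) (X : nat -> {RV P >-> (R * R)%type})
    (n : nat) (Q : probability (n.-tuple (R * R)%type) R) : Prop :=
  let near0 (r : R) : set T :=
    [set w | euclidean_norm (walk X n.+1 w) <= r] in
  (forall r : R, 0 < r -> (0 < P (near0 r))%E) /\
  (forall B : set (n.-tuple (R * R)%type), measurable B ->
    cond_prob P (walk_path X n @^-1` B) (near0 r) @[r --> 0^'+] --> fine (Q B)).

(* Main.v *)
Require Import Defs.
From HB Require Import structures.
From mathcomp Require Import all_boot all_order all_algebra.
From mathcomp Require Import all_classical all_reals all_analysis.
From mathcomp Require Import measurable_realfun.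
From mathcomp Require Import zify ring lra.

Set Implicit Arguments.
Unset Strict Implicit.
Unset Printing Implicit Defensive.

Import Order.TTheory GRing.Theory Num.Theory.
Import numFieldNormedType.Exports.

Local Open Scope classical_set_scope.
Local Open Scope ring_scope.

(* Let m = n + 1, so S_m = 0. In general position, 0 is outside the hull of
   S_1, ..., S_n iff some S_k is the clockwise-most of these points, i.e.
   det(S_k, S_j) > 0 for all j <> k, and this k is unique. Fix k and view
   det(S_k, S_j) as the height of S_j: both 0 = S_0 and S_k have height 0,
   so the event says that index 0 is the lowest among 0, ..., k-1 and index
   k the lowest among k, ..., m-1. Rotating the first k increments and,
   independently, the last m - k ones moves the two lowest indices through
   all k (m - k) possible positions without changing S_k, so by
   exchangeability the event has probability 1 / (k (m - k)).

   For the conditional bridge, the difference bridge satisfies the same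
   formula conditionally on |W_m| <= r, and differs from the walk by at most
   r; as the events are open, this bounds the limiting probability of each
   of the k (m - k) positions by 1 / (k (m - k)), and equality follows since
   the limit law, being absolutely continuous with respect to that of the
   walk, gives them total mass 1. *)

(** * Convex hulls of planar points *)

Definition cross (R : realType) (u v : R * R) : R := u.1 * v.2 - u.2 * v.1.

Definition inner (R : realType) (u v : R * R) : R := u.1 * v.1 + u.2 * v.2.

Lemma inner_gt0 (R : realType) (u : R * R) : u != 0 -> 0 < inner u u.
Proof.
move=> u0; rewrite lt_def /inner -!expr2 addr_ge0 ?sqr_ge0// andbT.
apply: contra u0; rewrite paddr_eq0 ?sqr_ge0// !sqrf_eq0.
move=> /andP[/eqP a /eqP b].
by rewrite (surjective_pairing u) a b.
Qed.

Lemma crossBr (R : realType) (u v w : R * R) :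
  cross u (v - w) = cross u v - cross u w.
Proof. rewrite /cross /=; ring. Qed.

Lemma crossDr (R : realType) (u v w : R * R) :
  cross u (v + w) = cross u v + cross u w.
Proof. rewrite /cross /=; ring. Qed.

Lemma crossvv (R : realType) (u : R * R) : cross u u = 0.
Proof. rewrite /cross; ring. Qed.

Lemma cross0r (R : realType) (u : R * R) : cross u 0 = 0.
Proof. rewrite /cross /=; ring. Qed.

Lemma crossC (R : realType) (u v : R * R) : cross u v = - cross v u.
Proof. rewrite /cross; ring. Qed.

(** When the three cyclic cross products are nonnegative, this identity exhibits 0 as a nonnegative
    combination of the vectors. *)
Lemma cross_cyclic (R : realType) (u v w : R * R) :
  cross v w *: u + cross w u *: v + cross u v *: w = 0.
Proof.
by rewrite /cross; congr pair; rewrite /= /GRing.scale /=; ring.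
Qed.

Lemma convex_segment (R : realType) (V : lmodType R) (C : set V) (x y : V)
    (t : R) :
  @convex_set R V C -> C x -> C y -> 0 <= t <= 1 -> C (t *: x + (1 - t) *: y).
Proof.
move=> cC Cx Cy t01.
have ti : Itv.spec (@Itv.num_sem R) (Itv.Real `[0%Z, 1%Z]) t.
  rewrite /Itv.spec /= /Itv.num_sem /=; apply/andP; split.
    by rewrite num_real.
  by rewrite in_itv.
have := cC x y (Itv.mk ti); rewrite !inE; exact.
Qed.

(** Dividing by [a + b + c] makes 0 a barycentre, reached by two segments: from [x] to [y], then
    towards [z]. If [a + b = 0], only [z] has weight, which forces [z = 0]. *)
Lemma convex_origin (R : realType) (V : lmodType R) (C : set V) (x y z : V)
    (a b c : R) :
  @convex_set R V C -> C x -> C y -> C z -> 0 <= a -> 0 <= b -> 0 <= c ->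
  0 < a + b + c -> a *: x + b *: y + c *: z = 0 -> C 0.
Proof.
move=> cC Cx Cy Cz a0 b0 c0 s0 e.
have [ab0|ab0] := eqVneq (a + b) 0.
  have a00 : a = 0 by lra.
  have b00 : b = 0 by lra.
  move: e; rewrite a00 b00 !scale0r !add0r => /eqP; rewrite scaler_eq0.
  case/orP => /eqP h; last by rewrite -h.
  by move: s0; rewrite a00 b00 h; rewrite !addr0 ltxx.
have ab : 0 < a + b by rewrite lt_def ab0 addr_ge0.
have Cw : C ((a / (a + b)) *: x + (1 - a / (a + b)) *: y).
  apply: convex_segment => //.
  by rewrite ler_pdivrMr// mul1r lerDl b0 andbT divr_ge0// ltW.
have := convex_segment (t := (a + b) / (a + b + c)) cC Cw Cz.
rewrite scalerDr !scalerA.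
have -> : (a + b) / (a + b + c) * (a / (a + b)) = (a + b + c)^-1 * a.
  by field; rewrite ab0 gt_eqF.
have -> : (a + b) / (a + b + c) * (1 - a / (a + b)) = (a + b + c)^-1 * b.
  by field; rewrite ab0 gt_eqF.
have -> : 1 - (a + b) / (a + b + c) = (a + b + c)^-1 * c.
  by field; rewrite gt_eqF.
rewrite -!scalerA -!scalerDr e scaler0; apply.
by rewrite ler_pdivrMr// mul1r lerDl c0 andbT divr_ge0// ltW.
Qed.

(* [w] lies strictly counterclockwise of [v], or on the open ray of [v]. *)
Definition ccw (R : realType) (v w : R * R) : Prop :=
  0 < cross v w \/ (cross v w = 0 /\ 0 < inner v w).

(** A combination is strictly inside the half-plane as soon as one point of positive weight is;
    otherwise the points carrying weight lie on the open ray. *)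
Lemma ccw_convex (R : realType) (v : R * R) :
  @convex_set R (R * R)%type (ccw v).
Proof.
move=> x y t; rewrite !inE => hx hy.
have t0 : 0 <= t%:num by [].
have t1 : 0 <= 1 - t%:num by rewrite subr_ge0.
have -> : conv t x y = t%:num *: (x : R * R) + (1 - t%:num) *: (y : R * R).
  by [].
rewrite /ccw.
have -> u w : cross v (t%:num *: u + (1 - t%:num) *: w) =
    t%:num * cross v u + (1 - t%:num) * cross v w.
  by rewrite /cross /= /GRing.scale /=; ring.
have -> u w : inner v (t%:num *: u + (1 - t%:num) *: w) =
    t%:num * inner v u + (1 - t%:num) * inner v w.
  by rewrite /inner /= /GRing.scale /=; ring.
have [->|tn0] := eqVneq t%:num 0.
  by rewrite !mul0r !add0r subr0 !mul1r; case: hy; [left|right].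
have tp : 0 < t%:num by rewrite lt_def tn0.
case: hx => [x0|[x0 ix]].
  left; rewrite ltr_pwDl ?mulr_gt0 ?mulr_ge0//.
  by case: hy => [|[->]//]; exact: ltW.
case: hy => [y0|[y0 iy]]; last first.
  right; split; first by rewrite x0 y0 !mulr0 addr0.
  by rewrite ltr_pwDl ?mulr_gt0 ?mulr_ge0// ltW.
have [t10|t1n] := eqVneq (1 - t%:num) 0.
  by right; rewrite t10 !mul0r !addr0 x0 mulr0 mulr_gt0.
by left; rewrite x0 mulr0 add0r mulr_gt0// lt_def t1n.
Qed.

(** Only collinear points are at issue: if they did not point the same way, the segment between them
    would contain 0. *)
Lemma ccw_total (R : realType) (C : set (R * R)) (x y : R * R) :
  @convex_set R (R * R)%type C -> ~ C 0 -> C x -> C y -> ccw x y \/ ccw y x.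
Proof.
move=> cC C0 Cx Cy; rewrite /ccw (crossC y x).
have [c0|c0|c0] := ltgtP (cross x y) 0.
- by right; left; rewrite oppr_gt0.
- by left; left.
rewrite c0 oppr0; left; right; split=> //.
rewrite ltNge; apply/negP => i0; apply: C0.
have [y0|/inner_gt0 y0] := eqVneq y 0; first by rewrite -y0.
(* For collinear vectors [inner y y *: x = inner x y *: y]; the third weight is a dummy. *)
apply: (@convex_origin R (R * R)%type C x y y
  (inner y y) (- inner x y) 0) => //.
- exact: ltW.
- by rewrite oppr_ge0.
- by rewrite addr0 ltr_wpDr// oppr_ge0.
move: c0; rewrite /cross /inner => c0.
apply/eqP; rewrite -pair_eqE /= /GRing.scale /=; apply/andP; split; apply/eqP.
  transitivity (y.2 * (x.1 * y.2 - x.2 * y.1)); first by ring.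
  by rewrite c0 mulr0.
transitivity (- y.1 * (x.1 * y.2 - x.2 * y.1)); first by ring.
by rewrite c0 mulr0.
Qed.

(** Turning counterclockwise is not transitive in the whole plane, since three vectors can wind
    around 0; but then [cross_cyclic] writes 0 as a combination of points of [C], which is
    excluded. *)
Lemma ccw_trans (R : realType) (C : set (R * R)) (x y z : R * R) :
  @convex_set R (R * R)%type C -> ~ C 0 -> C x -> C y -> C z ->
  ccw x y -> ccw y z -> ccw x z.
Proof.
move=> cC C0 Cx Cy Cz xy yz.
have xy0 : 0 <= cross x y by case: xy => [/ltW//|[-> _]].
have yz0 : 0 <= cross y z by case: yz => [/ltW//|[-> _]].
have [//|zx] := ccw_total cC C0 Cx Cz.
have [c0|c0|c0] := ltgtP (cross z x) 0.
- by left; rewrite crossC oppr_gt0.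
- exfalso; apply: C0.
  apply: (convex_origin cC Cx Cy Cz yz0 (ltW c0) xy0); first by lra.
  exact: cross_cyclic.
right; rewrite crossC c0 oppr0; split => //.
case: zx => [|[_]]; first by rewrite c0 ltxx.
by rewrite /inner mulrC [z.2 * _]mulrC.
Qed.

(** If such a [k] exists, [ccw (s k)] is a convex set that contains all the points but not 0.
    Conversely, on a convex set avoiding 0 the relation [ccw] is total and transitive, so induction
    finds a first point among finitely many. *)
Lemma conv_hull0P (R : realType) (n : nat) (s : nat -> R * R) : (0 < n)%N ->
  ~ conv_hull [set s k | k in [set k | (1 <= k <= n)%N]] 0 <->
  exists2 k, (1 <= k <= n)%N & forall j, (1 <= j <= n)%N -> ccw (s k) (s j).
Proof.
move=> n0; split; last first.
  move=> [k _ hk] /(_ (ccw (s k)))[].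
  - split; first exact: ccw_convex.
    by move=> _ [j hj <-]; exact: hk.
  - by rewrite cross0r ltxx.
  - by rewrite /inner /= !mulr0 addr0 ltxx => -[].
set C := conv_hull _ => C0.
have cC : @convex_set R (R * R)%type C.
  move=> x y t; rewrite !inE => Cx Cy D [cD AD].
  have := cD x y t; rewrite !inE; apply.
  - exact: Cx.
  - exact: Cy.
have Cs k : (1 <= k <= n)%N -> C (s k).
  by move=> hk D [_ AD]; apply: AD; exists k.
have : forall p, (1 <= p <= n)%N ->
    exists2 k, (1 <= k <= n)%N & forall j, (1 <= j <= p)%N -> ccw (s k) (s j).
  elim=> // p IH /andP[_ pn].
  have cpp : ccw (s p.+1) (s p.+1).
    by case: (ccw_total cC C0 (Cs p.+1 pn) (Cs p.+1 pn)).
  have [p0|p0] := posnP p.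
    exists p.+1 => [|j hj]; first by rewrite pn.
    by have -> : j = p.+1 by lia.
  have [|k hk hkj] := IH; first by lia.
  have [kp|pk] := ccw_total cC C0 (Cs _ hk) (Cs p.+1 pn).
    exists k => // j hj; have [->//|jp] := eqVneq j p.+1.
    by apply: hkj; lia.
  exists p.+1 => // j hj; have [->//|jp] := eqVneq j p.+1.
  have kj : ccw (s k) (s j) by apply: hkj; lia.
  have Cj : C (s j) by apply: Cs; lia.
  exact: (ccw_trans cC C0 (Cs p.+1 pn) (Cs _ hk) Cj pk kj).
by move=> /(_ n); rewrite n0 leqnn => /(_ isT).
Qed.

(** The subtracted term bounds how much the cross product can drop when [u] and [v] are shifted by
    multiples, with coefficients of size at most 1, of one vector of norm at most [e]. *)
Definition margin (R : realType) (e : R) (u v : R * R) : R :=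
  cross u v - e * (`|u.1| + `|u.2| + `|v.1| + `|v.2|).

Lemma margin0 (R : realType) (u v : R * R) : margin 0 u v = cross u v.
Proof. by rewrite /margin mul0r subr0. Qed.

(* With respect to the height [cross (s k)], the point [s a] is the lowest one
   among those of index in [0, k), and [s b] among those of index in [k, m),
   both with some room measured by [e]. *)
Definition lowest (R : realType) (e : R) (m k a b : nat) (s : nat -> R * R)
    : Prop :=
  forall j, (j < m)%N ->
    ((j < k)%N -> j != a -> 0 < margin e (s k) (s j - s a)) /\
    ((k <= j)%N -> j != b -> 0 < margin e (s k) (s j - s b)).

(** For each [k] this forbids ties of the height [cross (s k)] inside the blocks [0, k) and [k, m).
    Ties across the blocks have to be allowed: when [s 0 = 0], the indices 0 and [k] always have
    equal height. *)
Definition general_position (R : realType) (m : nat) (s : nat -> R * R)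
    : Prop :=
  forall k i j, (0 < k)%N -> (i < j < m)%N -> (j < k)%N || (k <= i)%N ->
    (k < m)%N -> cross (s k) (s j - s i) != 0.

Lemma lowest_inj (R : realType) (m k a b a' b' : nat) (s : nat -> R * R) :
  (k < m)%N -> (a < k)%N -> (k <= b < m)%N -> (a' < k)%N -> (k <= b' < m)%N ->
  lowest 0 m k a b s -> lowest 0 m k a' b' s -> a = a' /\ b = b'.
Proof.
move=> km ak bk ak' bk' h h'; split; apply/eqP/negPn/negP => ne.
  have : 0 < margin 0 (s k) (s a - s a').
    by apply: (proj1 (h' a _)) => //; lia.
  have : 0 < margin 0 (s k) (s a' - s a).
    by apply: (proj1 (h a' _)) => //; lia.
  by rewrite !margin0 !crossBr; lra.
have : 0 < margin 0 (s k) (s b - s b').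
  by apply: (proj2 (h' b _)) => //; lia.
have : 0 < margin 0 (s k) (s b' - s b).
  by apply: (proj2 (h b' _)) => //; lia.
by rewrite !margin0 !crossBr; lra.
Qed.

Lemma exists_argmin (R : realType) (p q : nat) (h : nat -> R) :
  (p < q)%N -> exists2 a, (p <= a < q)%N &
    forall j, (p <= j < q)%N -> h a <= h j.
Proof.
elim: q => // q IH; rewrite ltnS leq_eqVlt => /orP[/eqP->|pq].
  exists q; first by lia.
  by move=> j hj; have -> : j = q by lia.
have [a ha aj] := IH pq; have [hq|hq] := leP (h a) (h q).
  exists a => [|j hj]; first by lia.
  by have [->//|jq] := eqVneq j q; apply: aj; lia.
exists q => [|j hj]; first by lia.
have [->//|jq] := eqVneq j q; apply: le_trans (ltW hq) _; apply: aj; lia.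
Qed.

(** General position rules out ties, so the minimum over each block is strict. *)
Lemma exists_lowest (R : realType) (m k : nat) (s : nat -> R * R) :
  (0 < k < m)%N -> general_position m s ->
  exists a b, [/\ (a < k)%N, (k <= b < m)%N & lowest 0 m k a b s].
Proof.
move=> /andP[k0 km] gp.
have [a ha aj] := exists_argmin (fun j => cross (s k) (s j)) k0.
have [b hb bj] := exists_argmin (fun j => cross (s k) (s j)) km.
have ne i j : (i < m)%N -> (j < m)%N -> (i < k)%N == (j < k)%N -> i != j ->
    cross (s k) (s i) != cross (s k) (s j).
  move=> im jm ij; rewrite neq_ltn => /orP[|] lij.
    rewrite eq_sym -subr_eq0 -crossBr; apply: gp => //; lia.
  by rewrite -subr_eq0 -crossBr; apply: gp => //; lia.
exists a, b; split => // j jm; split => [jk ja|kj jb].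
  rewrite margin0 crossBr subr_gt0 lt_neqAle aj ?jk// andbT eq_sym.
  by apply: ne => //; lia.
rewrite margin0 crossBr subr_gt0 lt_neqAle bj ?kj// andbT eq_sym.
by apply: ne => //; lia.
Qed.

(** Both [s 0 = 0] and [s k] have height 0, so being lowest in their blocks amounts to
    [0 < cross (s k) (s j)] for every other [j]. This is [ccw] without its collinear case, which
    general position excludes for [j != k]. *)
Lemma conv_hull0_lowest (R : realType) (n : nat) (s : nat -> R * R) :
  (2 <= n)%N -> s 0%N = 0 -> general_position n.+1 s ->
  ~ conv_hull [set s k | k in [set k | (1 <= k <= n)%N]] 0 <->
  exists2 k, (1 <= k <= n)%N & lowest 0 n.+1 k 0 k s.
Proof.
move=> n2 s0 gp; rewrite conv_hull0P; last by lia.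
split=> -[k hk h]; exists k => // j hj.
  have gt0 i : (1 <= i <= n)%N -> i != k -> 0 < cross (s k) (s i).
    move=> hi ik; suff ne : cross (s k) (s i) != 0.
      by have [//|[/eqP]] := h i hi; rewrite (negPf ne).
    have [ltik|leki] := ltnP i k.
      by rewrite -(subr0 (s i)) -s0; apply: gp; lia.
    by have := gp k k i; rewrite crossBr crossvv subr0; apply; lia.
  split => hkj nj.
    by rewrite s0 margin0 subr0 gt0//; lia.
  by rewrite margin0 crossBr crossvv subr0 gt0//; lia.
have gt0 i : (1 <= i <= n)%N -> i != k -> 0 < cross (s k) (s i).
  move=> hi ik; have [|h1 h2] := h i; first by lia.
  have [ltik|leki] := ltnP i k.
    by move: (h1 ltik); rewrite s0 margin0 subr0; apply; lia.
  by move: (h2 leki ik); rewrite margin0 crossBr crossvv subr0.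
have [->|jk] := eqVneq j k; last by left; exact: gt0.
right; split; first exact: crossvv.
(* The case [j = k] of [ccw] requires [s k != 0]; as [n >= 2], there is another index, whose
   positive cross product with [s k] gives this. *)
have [i hi ik] : exists2 i, (1 <= i <= n)%N & i != k.
  by have [->|k1] := eqVneq k 1%N; [exists 2%N|exists 1%N]; lia.
apply: inner_gt0; apply/eqP => sk0.
by have := gt0 i hi ik; rewrite sk0 /cross /= !mul0r subrr ltxx.
Qed.

(** For two distinct such indices the cross product of [s k] and [s l] would be positive in both
    orders, against antisymmetry. *)
Lemma lowest_index_inj (R : realType) (m k l : nat) (s : nat -> R * R) :
  s 0%N = 0 -> (0 < k < m)%N -> (0 < l < m)%N ->
  lowest 0 m k 0 k s -> lowest 0 m l 0 l s -> k = l.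
Proof.
move=> s0; wlog kl : k l / (k < l)%N => [wl hk hl h h'|].
  by have [kl|kl|//] := ltngtP k l; [apply: wl|apply/esym; apply: wl].
move=> hk hl h h'.
have : 0 < margin 0 (s k) (s l - s k).
  by apply: (proj2 (h l _)) => //; lia.
have : 0 < margin 0 (s l) (s k - s 0%N).
  by apply: (proj1 (h' k _)) => //; lia.
rewrite !margin0 !crossBr crossvv s0 cross0r !subr0 (crossC (s l)) oppr_gt0.
by move=> /ltW; rewrite leNgt => /negP.
Qed.

(** * Exchanging blocks of increments *)

(* Exchanges the adjacent blocks [p, q) and [q, r) of indices. *)
Definition swap_index (p q r i : nat) : nat :=
  if (i < p)%N then i else if (i < p + (r - q))%N then (i - p + q)%N
  else if (i < r)%N then (i - (r - q))%N else i.

(** These are the partial sums after the exchange of increments: the block [q, r) now starts from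
    [s p], and [p, q) follows it. The sequence is arbitrary, so that the formula serves for the walk
    and for its bridge. *)
Definition swap_path (V : zmodType) (p q r : nat) (s : nat -> V) (k : nat)
    : V :=
  if (k <= p)%N then s k else if (k <= p + (r - q))%N then
    s p + s (k - p + q)%N - s q
  else if (k <= r)%N then s (k - (r - q))%N + s r - s q else s k.

Lemma swap_index_inj (p q r : nat) : (p <= q <= r)%N ->
  injective (swap_index p q r).
Proof.
move=> pqr i j; rewrite /swap_index.
by repeat (case: ifP => ?); lia.
Qed.

Lemma walkS (T : Type) (V : zmodType) (X : nat -> T -> V) k w :
  walk X k.+1 w = walk X k w + X k w.
Proof. by rewrite /walk big_ord_recr. Qed.

Lemma walk0 (T : Type) (V : zmodType) (X : nat -> T -> V) w :
  walk X 0 w = 0.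
Proof. by rewrite /walk big_ord0. Qed.

(** Induction on [k], piece by piece; the side cases are junctions of pieces, some of which occur
    only for empty blocks. *)
Lemma walk_swap (T : Type) (V : zmodType) (X : nat -> T -> V) (p q r k : nat)
    (w : T) : (p <= q <= r)%N ->
  walk (fun i => X (swap_index p q r i)) k w = swap_path p q r (walk X ^~ w) k.
Proof.
move=> pqr; elim: k => [|k IH]; first by rewrite /swap_path /= !walk0.
rewrite walkS IH /swap_path /swap_index.
have [ltkp|lepk] := ltnP k p; first by rewrite ltnW// walkS.
have [ltkq|leqk] := ltnP k (p + (r - q)).
  have -> : (k.+1 - p + q = (k - p + q).+1)%N by lia.
  rewrite walkS (ltnW ltkq); case: ifP => [lekp|_]; last first.
    by rewrite [LHS]addrAC [in RHS]addrA.
  have -> : k = p by lia.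
  by rewrite subnn add0n [walk X q w + _]addrC addrA addrK.
have [ltkr|lerk] := ltnP k r.
  have -> : (k.+1 - (r - q) = (k - (r - q)).+1)%N by lia.
  rewrite walkS (addrAC (walk X _ w) (X _ w)) [RHS]addrAC.
  have [lekp|ltpk] := leqP k p.
    have -> : k = p by lia.
    have -> : q = r by lia.
    by rewrite subnn subn0 addrK.
  rewrite (ltnW ltkr); case: ifP => [lek|//].
  have -> : k = (p + (r - q))%N by lia.
  have -> : (p + (r - q) - p + q)%N = r by lia.
  by rewrite addnK.
rewrite walkS.
have [lekp|ltpk] := leqP k p; first by [].
have [lekq|ltqk] := leqP k (p + (r - q)).
  have -> : (k - p + q)%N = r by lia.
  have -> : p = q by lia.
  have -> : k = r by lia.
  by rewrite [walk X q w + _]addrC addrK.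
have [lekr|//] := leqP k r.
have -> : k = r by lia.
have -> : (r - (r - q) = q)%N by lia.
by rewrite [walk X q w + _]addrC addrK.
Qed.

Lemma swap_path_last (V : zmodType) (p q r m : nat) (s : nat -> V) :
  (p <= q <= r)%N -> (r <= m)%N -> swap_path p q r s m = s m.
Proof.
move=> pqr rm; rewrite /swap_path; case: ifP => // h1; case: ifP => [h2|h2].
  have -> : (m - p + q)%N = m by lia.
  have -> : p = q by lia.
  by rewrite [_ + s m]addrC addrK.
case: ifP => // h3.
have -> : r = m by lia.
have -> : (m - (m - q))%N = q by lia.
by rewrite [_ + s m]addrC addrK.
Qed.

(** Every nontrivial piece of [swap_path] has the form [s c + s d - s a] at the index [c + d - a],
    and the drift removed from the walk is linear in the index, so it is carried along exactly. *)
Lemma difference_bridge_swap (T : Type) (R : realType) (V : lmodType R)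
    (X : nat -> T -> V) (n p q r k : nat) (w : T) :
  (p <= q <= r)%N -> (r <= n.+1)%N ->
  difference_bridge (fun i => X (swap_index p q r i)) n k w =
  swap_path p q r (fun j => difference_bridge X n j w) k.
Proof.
move=> pqr rn; rewrite /difference_bridge !walk_swap//.
rewrite (swap_path_last (m := n.+1))//.
have lin (a b c d : nat) : (a + b = c + d)%N ->
    walk X c w - (c%:R / n.+1%:R) *: walk X n.+1 w +
    (walk X d w - (d%:R / n.+1%:R) *: walk X n.+1 w) -
    (walk X a w - (a%:R / n.+1%:R) *: walk X n.+1 w) =
    walk X c w + walk X d w - walk X a w - (b%:R / n.+1%:R) *: walk X n.+1 w.
  move=> abcd; rewrite opprB [X in X + _ = _]addrACA -opprD -scalerDl -mulrDl.
  rewrite -natrD -abcd addnC natrD mulrDl scalerDl opprD.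
  by rewrite [X in X + _ = _]addrA subrKA [LHS]addrAC.
rewrite /swap_path; case: ifP => // h1; case: ifP => h2.
  by rewrite (lin q k); last lia.
by case: ifP => // h3; rewrite (lin q k)//; lia.
Qed.

(** The exchange rotates the first [k] indices by [a]: up to multiples of [s k], which have height
    0, the new point [j] is [s (j + a) - s a] with [j + a] reduced modulo [k]. All heights in the
    block are thus shifted by that of [s a], and index [a] moves to 0. *)
Lemma lowest_swapl (R : realType) (m k a b : nat) (s : nat -> R * R) :
  (a < k < m)%N -> (k <= b)%N -> s 0%N = 0 ->
  lowest 0 m k 0 b (swap_path 0 a k s) <-> lowest 0 m k a b s.
Proof.
move=> akm kb s0.
have sE j : (k <= j)%N -> swap_path 0 a k s j = s j.
  move=> kj; rewrite /swap_path leqn0; case: ifP => // _; case: ifP => h.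
    have -> : j = k by lia.
    have -> : a = 0%N by lia.
    by rewrite s0 add0r subr0 subn0 addn0.
  case: ifP => // h'; have -> : j = k by lia.
  have -> : (k - (k - a) = a)%N by lia.
  by rewrite [s a + _]addrC addrK.
have sC j : (j < k)%N -> cross (s k) (swap_path 0 a k s j - 0) =
    cross (s k) (s (if (j + a < k)%N then j + a else j + a - k)%N - s a).
  move=> jk; rewrite subr0 /swap_path leqn0 add0n; case: ifP => [/eqP ->|j0].
    by rewrite add0n ifT ?subrr ?s0//; lia.
  case: ifP => h.
    rewrite s0 add0r subn0; case: ifP => h' //.
    have -> : (j + a)%N = k by lia.
    by rewrite subnn s0 !crossBr crossvv cross0r.
  rewrite ifT ?ifF; [|lia..].
  have -> : (j - (k - a) = j + a - k)%N by lia.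
  by rewrite addrAC !crossDr crossvv addr0.
have s'0 : swap_path 0 a k s 0 = 0 by rewrite /swap_path /=.
(* Surjectivity of the rotation, for the direct implication. *)
have hi j : (a < k)%N -> (j < k)%N -> exists2 i, (i < k)%N &
    (if (i + a < k)%N then i + a else i + a - k)%N = j.
  move=> ak jk; exists (if (a <= j)%N then j - a else j + k - a)%N.
    by case: ifP => ?; lia.
  by case: (leqP a j) => ?; case: ifP => ?; lia.
have ak : (a < k)%N by lia.
split=> h j jm; split=> jk ja.
- have [i ik ij] := hi j ak jk.
  have [|+ _] := h i; first by lia.
  rewrite sE// s'0 !margin0 sC// ij; apply => //.
  by apply: contra ja => /eqP i0; rewrite -ij i0 add0n ak.
- by have [_] := h j jm; rewrite !sE//; exact.
- rewrite sE// s'0 margin0 sC//; set i := (if _ then _ else _).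
  have ik : (i < k)%N by rewrite /i; case: ifP; lia.
  have [|+ _] := h i; first by lia.
  by rewrite margin0; apply => //; rewrite /i; case: ifP => ?; lia.
- by have [_] := h j jm; rewrite !sE//; exact.
Qed.

(** The same rotation for the block [k, m), by [b - k]. Wrapping around passes from [s m = 0] to
    [s k], again at equal height, so index [b] moves to [k]. *)
Lemma lowest_swapr (R : realType) (m k b : nat) (s : nat -> R * R) :
  (0 < k)%N -> (k <= b < m)%N -> s m = 0 ->
  lowest 0 m k 0 k (swap_path k b m s) <-> lowest 0 m k 0 b s.
Proof.
move=> k0 kbm sm.
have sE j : (j <= k)%N -> swap_path k b m s j = s j.
  by rewrite /swap_path => ->.
have sC j : (k <= j < m)%N -> cross (s k) (swap_path k b m s j - s k) =
    cross (s k) (s (if (j - k + b < m)%N then j - k + b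
                    else j + b - m)%N - s b).
  move=> jk; rewrite /swap_path; case: ifP => [jk'|kj].
    have -> : j = k by lia.
    by rewrite subnn add0n ifT ?subrr//; lia.
  case: ifP => h.
    case: ifP => h'; first by rewrite addrAC [s k + _]addrC addrK.
    have -> : (j - k + b)%N = m by lia.
    have -> : (j + b - m)%N = k by lia.
    by rewrite sm addr0 addrAC subrr !crossBr crossvv cross0r.
  rewrite ifT ?ifF; [|lia..].
  have -> : (j - (m - b) = j + b - m)%N by lia.
  by rewrite sm addr0 !crossBr crossvv subr0.
have hi j : (k <= j < m)%N -> exists2 i, (k <= i < m)%N &
    (if (i - k + b < m)%N then i - k + b else i + b - m)%N = j.
  move=> jk; exists (if (b <= j)%N then j - b + k else j + m - b)%N.
    by case: ifP => ?; lia.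
  by case: (leqP b j) => ?; case: ifP => ?; lia.
split=> h j jm; split=> jk ja.
- by have [+ _] := h j jm; rewrite !sE//; [exact|exact: ltnW].
- have [|i ik ij] := hi j; first by lia.
  have [|_] := h i; first by lia.
  rewrite sE// !margin0 sC// ij; apply; first by lia.
  by apply: contra ja => /eqP ie; rewrite -ij ie; case: ifP; lia.
- by have [+ _] := h j jm; rewrite !sE//; [exact|exact: ltnW].
- rewrite sE// margin0 sC//; last by lia.
  set i := (if _ then _ else _).
  have ik : (k <= i < m)%N by rewrite /i; case: ifP; lia.
  have [|_] := h i; first by lia.
  by rewrite margin0; apply; [lia|rewrite /i; case: ifP => ?; lia].
Qed.

(** * Measurability *)

Lemma measurable_pairD (R : realType) (d : measure_display)
    (T : measurableType d) (f g : T -> R * R) :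
  measurable_fun setT f -> measurable_fun setT g ->
  measurable_fun setT (fun w => f w + g w).
Proof.
move=> mf mg; apply/measurable_fun_pairP; split; apply: measurable_funD;
  by apply: measurableT_comp.
Qed.

Lemma measurable_pairZ (R : realType) (d : measure_display)
    (T : measurableType d) (c : R) (f : T -> R * R) :
  measurable_fun setT f -> measurable_fun setT (fun w => c *: f w).
Proof.
move=> mf; apply/measurable_fun_pairP; split; apply: measurable_funM => //;
  by apply: measurableT_comp.
Qed.

Lemma measurable_pairB (R : realType) (d : measure_display)
    (T : measurableType d) (f g : T -> R * R) :
  measurable_fun setT f -> measurable_fun setT g ->
  measurable_fun setT (fun w => f w - g w).
Proof.
move=> mf mg; apply: measurable_pairD => //.
rewrite (_ : (fun w => - g w) = (fun w => - 1 *: g w)).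
  exact: measurable_pairZ.
by apply/funext => w; rewrite scaleN1r.
Qed.

Lemma measurable_pair_sum (R : realType) (d : measure_display)
    (T : measurableType d) (m : nat) (f : nat -> T -> R * R) :
  (forall i, (i < m)%N -> measurable_fun setT (f i)) ->
  measurable_fun setT (fun w => \sum_(i < m) f i w).
Proof.
elim: m => [|m IH] mf.
  rewrite (_ : (fun _ => _) = cst 0) //.
  by apply/funext => w; rewrite big_ord0.
rewrite (_ : (fun _ => _) = (fun w => \sum_(i < m) f i w + f m w)).
  by apply: measurable_pairD; [apply: IH => i im|]; apply: mf; lia.
by apply/funext => w; rewrite big_ord_recr.
Qed.

Lemma measurable_cross (R : realType) (d : measure_display)
    (T : measurableType d) (f g : T -> R * R) :
  measurable_fun setT f -> measurable_fun setT g ->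
  measurable_fun setT (fun w => cross (f w) (g w)).
Proof.
move=> mf mg; apply: measurable_funB; apply: measurable_funM;
  by apply: measurableT_comp.
Qed.

Lemma measurable_inner (R : realType) (d : measure_display)
    (T : measurableType d) (f g : T -> R * R) :
  measurable_fun setT f -> measurable_fun setT g ->
  measurable_fun setT (fun w => inner (f w) (g w)).
Proof.
move=> mf mg; apply: measurable_funD; apply: measurable_funM;
  by apply: measurableT_comp.
Qed.

Lemma measurable_margin (R : realType) (d : measure_display)
    (T : measurableType d) (e : R) (f g : T -> R * R) :
  measurable_fun setT f -> measurable_fun setT g ->
  measurable_fun setT (fun w => margin e (f w) (g w)).
Proof.
move=> mf mg; apply: measurable_funB; first exact: measurable_cross.
apply: measurable_funM => //.
by apply: measurable_funD; [apply: measurable_funD; [apply: measurable_funD|]|];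
  apply: measurableT_comp => //; apply: measurableT_comp.
Qed.

Lemma measurable_lt0 (R : realType) (d : measure_display)
    (T : measurableType d) (f : T -> R) :
  measurable_fun setT f -> measurable [set w | 0 < f w].
Proof.
move=> mf; rewrite -[X in measurable X]setTI.
have -> : [set w | 0 < f w] = f @^-1` `]0, +oo[.
  by apply/seteqP; split => w /=; rewrite in_itv/= andbT.
exact: mf.
Qed.

Lemma measurable_eq0 (R : realType) (d : measure_display)
    (T : measurableType d) (f : T -> R) :
  measurable_fun setT f -> measurable [set w | f w = 0].
Proof.
move=> mf; rewrite -[X in measurable X]setTI.
have -> : [set w | f w = 0] = f @^-1` [set 0] by [].
exact: mf.
Qed.

Lemma measurable_pair_eq0 (R : realType) (d : measure_display)
    (T : measurableType d) (f : T -> R * R) :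
  measurable_fun setT f -> measurable [set w | f w = 0].
Proof.
move=> mf; have -> : [set w | f w = 0] =
    [set w | (f w).1 = 0] `&` [set w | (f w).2 = 0].
  apply/seteqP; split => w /=; first by move=> ->.
  by case: (f w) => a b /= [-> ->].
by apply: measurableI; apply: measurable_eq0; exact: measurableT_comp.
Qed.

Lemma measurable_forall_lt (d : measure_display) (T : measurableType d)
    (m : nat) (A : nat -> set T) :
  (forall i, (i < m)%N -> measurable (A i)) ->
  measurable [set w | forall i, (i < m)%N -> A i w].
Proof.
move=> mA; have -> : [set w | forall i, (i < m)%N -> A i w] =
    \bigcap_(i in [set i | (i < m)%N]) A i by [].
exact: bigcap_measurableType.
Qed.

Lemma measurable_imply (d : measure_display) (T : measurableType d)
    (b : Prop) (A : set T) :
  (b -> measurable A) -> measurable [set w | b -> A w].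
Proof.
move=> mA; have [hb|hb] := pselect b.
  have -> : [set w | b -> A w] = A; last exact: mA.
  by apply/seteqP; split => w /=; [exact|move=> ? _].
have -> : [set w | b -> A w] = setT; last by [].
by apply/seteqP; split => // w _ /= /hb.
Qed.

Lemma measurable_lowest (R : realType) (d : measure_display)
    (T : measurableType d) (e : R) (m k a b : nat) (s : T -> nat -> R * R) :
  (k < m)%N -> (a < m)%N -> (b < m)%N ->
  (forall i, (i < m)%N -> measurable_fun setT (s ^~ i)) ->
  measurable [set w | lowest e m k a b (s w)].
Proof.
move=> km am bm ms; apply: measurable_forall_lt => j jm.
apply: measurableI; do 2! apply: measurable_imply => _;
  by apply/measurable_lt0/measurable_margin;
    [exact: ms|apply: measurable_pairB; exact: ms].
Qed.

Lemma measurable_coordinate (d : measure_display) (E : measurableType d)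
    (m : nat) (x0 : E) (i : nat) :
  measurable_fun setT (fun t : m.-tuple E => nth x0 t i).
Proof.
have [im|mi] := ltnP i m; last first.
  rewrite (_ : (fun _ => _) = cst x0) //.
  by apply/funext => t; rewrite nth_default// size_tuple.
rewrite (_ : (fun _ => _) = (fun t : m.-tuple E => tnth t (Ordinal im))).
  exact: measurable_tnth.
by apply/funext => t; rewrite (tnth_nth x0).
Qed.

(* Boxes form a pi-system generating the product sigma-algebra of tuples. *)
Lemma tuple_measure_unique (R : realType) (d : measure_display)
    (E : measurableType d) (m : nat)
    (mu nu : {measure set (m.-tuple E) -> \bar R}) :
  (mu setT < +oo)%E ->
  (forall B : 'I_m -> set E, (forall i, measurable (B i)) ->
    mu [set t | forall i, B i (tnth t i)] =
    nu [set t | forall i, B i (tnth t i)]) ->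
  forall A, measurable A -> mu A = nu A.
Proof.
move=> muoo munu A mA.
pose G := [set A : set (m.-tuple E) | exists B : 'I_m -> set E,
  (forall i, measurable (B i)) /\ A = [set t | forall i, B i (tnth t i)]].
have GT : G setT.
  by exists (fun _ => setT); split => //; apply/seteqP; split.
apply: (measure_unique G (fun _ => setT)) => //.
- apply/seteqP; split.
    apply: smallest_sub; first exact: smallest_sigma_algebra.
    move=> C; rewrite -bigcup_seq => -[i _ [B mB <-]].
    apply: sub_sigma_algebra.
    (* A cylinder over coordinate [i] is a box with full sides elsewhere. *)
    exists (fun j => if j == i then B else setT); split.
      by move=> j; case: ifP.
    rewrite setTI; apply/seteqP; split => t /=.
      by move=> Bt j; case: eqP => // ->.
    by move=> /(_ i); rewrite eqxx.
  apply: smallest_sub; first exact: sigma_algebra_measurable.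
  move=> _ [B [mB ->]].
  have -> : [set t | forall i, B i (tnth t i)] =
      \bigcap_(i in setT) ((fun t => tnth t i) @^-1` B i).
    by apply/seteqP; split => t /= h i; [move=> _; exact: h|exact: h].
  apply: fin_bigcap_measurable => // i _.
  by rewrite -[X in measurable X]setTI; exact: measurable_tnth.
- move=> _ _ [B [mB ->]] [C [mC ->]].
  exists (fun i => B i `&` C i); split.
    by move=> i; exact: measurableI.
  apply/seteqP; split => t /=; first by move=> [h1 h2] i; split.
  by move=> h; split => i; have [] := h i.
- by rewrite bigcup_const//; exists 0%N.
by move=> _ [B [mB ->]]; exact: munu.
Qed.

(** * Independent identically distributed sequences *)

(** The value does not depend on [rho]; exchangeability and the independence of a tuple from a
    further variable both come from this. *)
Lemma iid_box (R : realType) (d d' : measure_display) (T : measurableType d)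
    (E : measurableType d') (P : probability T R) (X : nat -> {RV P >-> E})
    (m : nat) (rho : nat -> nat) (B : nat -> set E) :
  iid X -> (forall i j, (i < m)%N -> (j < m)%N -> rho i = rho j -> i = j) ->
  (forall i, measurable (B i)) ->
  P [set w | forall i, (i < m)%N -> B i (X (rho i) w)] =
  (\prod_(i < m) fine (P (X 0%N @^-1` B i)))%:E.
Proof.
move=> [ind idd] rho_inj mB.
pose s := map rho (iota 0 m).
have us : uniq s.
  rewrite map_inj_in_uniq ?iota_uniq// => i j.
  by rewrite !mem_iota/= !add0n; exact: rho_inj.
have sidx i : (i < m)%N -> index (rho i) s = i.
  move=> im; rewrite -[RHS](@index_uniq _ 0%N i s) ?size_map ?size_iota//.
  by rewrite (nth_map 0%N) ?size_iota// nth_iota.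
(* Independence attaches a set to each variable, not to each position, so the side for [X j] is
   found from the position of [j] in [s]. *)
have -> : [set w | forall i, (i < m)%N -> B i (X (rho i) w)] =
    \bigcap_(j in [set` s]) (X j @^-1` B (index j s)).
  apply/seteqP; split => w /= h.
    move=> _ /= /mapP[i + ->]; rewrite mem_iota/= add0n => im.
    by rewrite sidx//; exact: h.
  move=> i im; have := h (rho i); rewrite /= sidx//; apply.
  by apply/mapP; exists i => //; rewrite mem_iota.
rewrite (ind s (fun j => B (index j s)))//; congr EFin.
rewrite big_map.
have -> : iota 0 m = index_iota 0 m by rewrite /index_iota subn0.
rewrite big_mkord; apply: eq_bigr => i _; rewrite sidx//.
by rewrite (idd (rho i) 0%N (B i) (mB i) : P _ = P _).
Qed.

Definition subsample (d d' : measure_display) (T : measurableType d)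
    (E : measurableType d') (R : realType) (P : probability T R)
    (X : nat -> {RV P >-> E}) (m : nat) (rho : nat -> nat) (w : T)
    : m.-tuple E :=
  [tuple X (rho i) w | i < m].

Lemma measurable_subsample (d d' : measure_display) (T : measurableType d)
    (E : measurableType d') (R : realType) (P : probability T R)
    (X : nat -> {RV P >-> E}) (m : nat) (rho : nat -> nat) :
  measurable_fun setT (subsample X m rho).
Proof.
apply/measurable_fun_tnthP => i.
rewrite (_ : _ \o _ = X (rho i)); first exact: measurable_funPT.
by apply/funext => w /=; rewrite tnth_mktuple.
Qed.

Lemma subsample_box (d d' : measure_display) (T : measurableType d)
    (E : measurableType d') (R : realType) (P : probability T R)
    (X : nat -> {RV P >-> E}) (m : nat) (rho : nat -> nat)
    (B : 'I_m -> set E) :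
  subsample X m rho @^-1` [set t | forall i, B i (tnth t i)] =
  [set w | forall i, (i < m)%N ->
    (if insub i is Some j then B j else setT) (X (rho i) w)].
Proof.
apply/seteqP; split => w /= h i; first by case: insubP => // j _ <- _;
  have := h j; rewrite tnth_mktuple.
have := h i (ltn_ord i).
by rewrite tnth_mktuple valK.
Qed.

(** By [iid_box] the two laws agree on boxes, which determine them. *)
Lemma exchangeable (d d' : measure_display) (T : measurableType d)
    (E : measurableType d') (R : realType) (P : probability T R)
    (X : nat -> {RV P >-> E}) (m : nat) (rho : nat -> nat)
    (A : set (m.-tuple E)) :
  iid X -> (forall i j, (i < m)%N -> (j < m)%N -> rho i = rho j -> i = j) ->
  measurable A ->
  P (subsample X m rho @^-1` A) = P (subsample X m id @^-1` A).
Proof.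
move=> iidX rho_inj mA.
apply: (@tuple_measure_unique R _ E m (pushforward P (subsample X m rho))
  (pushforward P (subsample X m id))) => //=.
1,2: exact: measurable_subsample.
- by move=> *; rewrite /pushforward preimage_setT probability_setT ltry.
move=> ? ? B mB; rewrite /pushforward !subsample_box.
rewrite (iid_box (B := fun i => if insub i is Some j then B j else setT))//.
  rewrite (iid_box (B := fun i => if insub i is Some j then B j else setT)
    (rho := id))//.
  by move=> i; case: insubP.
by move=> i; case: insubP.
Qed.

(** With [B] fixed, both sides are finite measures of [A]: the restriction of [P] to the event that
    [X p] lies in [B], and [P] scaled by the probability of that event. It suffices to compare them
    on boxes. *)
Lemma subsample_indep (d d' : measure_display) (T : measurableType d)
    (E : measurableType d') (R : realType) (P : probability T R)
    (X : nat -> {RV P >-> E}) (m p : nat) (rho : nat -> nat)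
    (A : set (m.-tuple E)) (B : set E) :
  iid X -> (forall i j, (i < m)%N -> (j < m)%N -> rho i = rho j -> i = j) ->
  (forall i, (i < m)%N -> rho i != p) ->
  measurable A -> measurable B ->
  (P (subsample X m rho @^-1` A `&` X p @^-1` B) =
   P (subsample X m rho @^-1` A) * P (X p @^-1` B))%E.
Proof.
move=> iidX rho_inj rhop mA mB.
have mD : measurable (X p @^-1` B) by exact: measurable_funPTI.
have D0 : 0 <= fine (P (X p @^-1` B)) by exact: fine_ge0.
have PD : P (X p @^-1` B) \is a fin_num by exact: fin_num_measure.
rewrite muleC -[P (X p @^-1` B)]fineK//.
apply: (@tuple_measure_unique R _ E m
  (pushforward (mrestr P mD) (subsample X m rho))
  (mscale (NngNum D0) (pushforward P (subsample X m rho)))) => //=.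
1,2: exact: measurable_subsample.
- by move=> *; rewrite /pushforward /mrestr preimage_setT setTI ltey_eq PD.
move=> ? ? C mC; rewrite /mscale /pushforward /mrestr /= fineK//.
rewrite /pushforward !subsample_box.
set C' := fun i => if insub i is Some j then C j else setT.
have mC' i : measurable (C' i) by rewrite /C'; case: insubP.
rewrite (iid_box iidX rho_inj mC').
(* Prepending [X p] with side [B] turns the intersection into a box for [m + 1] distinct
   variables. *)
pose D i := if i is j.+1 then C' j else B.
pose sigma i := if i is j.+1 then rho j else p.
have -> : [set w | forall i, (i < m)%N -> C' i (X (rho i) w)] `&` X p @^-1` B =
    [set w | forall i, (i < m.+1)%N -> D i (X (sigma i) w)].
  apply/seteqP; split => w /=; first by move=> [h1 h2] [|i] im //; exact: h1.
  by move=> h; split => [i im|]; [exact: (h i.+1)|exact: (h 0%N)].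
rewrite (iid_box iidX); last by case.
  rewrite big_ord_recl /= EFinM fineK ?fin_num_measure//; last first.
    exact: measurable_funPTI.
  by congr (_ * _)%E; exact/esym/(iidX.2 p 0%N B mB).
case=> [|i] [|j] //= im jm e.
- by move: (rhop j jm); rewrite -e eqxx.
- by move: (rhop i im); rewrite e eqxx.
- by congr S; exact: rho_inj.
Qed.

(** Fubini: by independence the joint law of the tuple and [X p] is a product, and every section of
    [N] is null. *)
Lemma independent_null (d d' : measure_display) (T : measurableType d)
    (E : measurableType d') (R : realType) (P : probability T R)
    (X : nat -> {RV P >-> E}) (m p : nat) (rho : nat -> nat)
    (N : set (m.-tuple E * E)) :
  iid X -> (forall i j, (i < m)%N -> (j < m)%N -> rho i = rho j -> i = j) ->
  (forall i, (i < m)%N -> rho i != p) -> measurable N ->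
  (forall t, P (X 0%N @^-1` [set x | N (t, x)]) = 0%E) ->
  P [set w | N (subsample X m rho w, X p w)] = 0%E.
Proof.
move=> iidX rho_inj rhop mN N0.
have mZ : measurable_fun setT (subsample X m rho).
  exact: measurable_subsample.
pose Z : {RV P >-> m.-tuple E} := mfun_Sub (mem_set mZ).
have mZX : measurable_fun setT (fun w => (Z w, X p w)).
  by apply: measurable_fun_pair; exact: measurable_funPT.
pose ZX : {RV P >-> (m.-tuple E * E)%type} := mfun_Sub (mem_set mZX).
have <- : (distribution P Z \x distribution P (X p))%E N =
    P [set w | N (subsample X m rho w, X p w)].
  apply: (@product_measure_unique _ _ _ _ R (distribution P Z)
    (distribution P (X p)) (distribution P ZX)) => // A B mA mB.
  exact: (subsample_indep iidX rho_inj rhop mA mB).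
rewrite /product_measure1 integral0_eq// => t _ /=.
rewrite -[RHS](N0 t); have mNt := measurable_xsection t mN.
by have := iidX.2 p 0%N _ mNt; rewrite /distribution /pushforward xsectionE.
Qed.

(** * General position *)

(** A vector whose cross product with [v] vanishes equals its orthogonal projection onto [v]. This
    is how vanishing cross products meet the hypothesis on lines. *)
Lemma affine_line_cross (R : realType) (p v : R * R) :
  v != 0 -> affine_line [set x | cross v (x - p) = 0].
Proof.
move=> v0; exists p, v; split => //; apply/seteqP; split => x /=; last first.
  by move=> [t _ <-]; rewrite /cross /= /GRing.scale /=; ring.
suff h y : cross v y = 0 -> exists t, t *: v = y.
  by move=> /h[t tv]; exists t => //; rewrite tv addrC subrK.
have /(inner_gt0) vv := v0; move=> /eqP; rewrite subr_eq0 => /eqP vy.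
have vvN : inner v v != 0 by rewrite gt_eqF.
exists (inner v y / inner v v).
apply: (scalerI vvN); rewrite scalerA mulrCA divff// mulr1.
apply/eqP; rewrite -pair_eqE /= /GRing.scale /= /inner.
apply/andP; split; apply/eqP.
  by transitivity (v.1 * v.1 * y.1 + v.2 * (v.1 * y.2));
    [ring|rewrite vy; ring].
by transitivity (v.2 * v.2 * y.2 + v.1 * (v.2 * y.1));
  [ring|rewrite -vy; ring].
Qed.

Lemma measurable_tuple_lincomb (R : realType) (n m : nat) (a : nat -> R) :
  measurable_fun setT
    (fun t : n.-tuple (R * R) => \sum_(i < m) a i *: nth 0 t i).
Proof.
apply: (measurable_pair_sum
  (f := fun i (t : n.-tuple (R * R)) => a i *: nth 0 t i)) => i _.
by apply: measurable_pairZ; exact: measurable_coordinate.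
Qed.

Definition lincomb (R : realType) (d : measure_display) (T : measurableType d)
    (P : probability T R) (X : nat -> {RV P >-> (R * R)%type}) (m : nat)
    (c : nat -> R) (w : T) : R * R :=
  \sum_(i < m) c i *: X i w.

(** As [bump p] enumerates the indices other than [p], the increment [X p] is separated from the
    others, on which one can then condition. *)
Lemma lincomb_subsample (R : realType) (d : measure_display)
    (T : measurableType d) (P : probability T R)
    (X : nat -> {RV P >-> (R * R)%type}) (n p : nat) (c : nat -> R) (w : T) :
  (p < n.+1)%N -> lincomb X n.+1 c w = c p *: X p w +
    \sum_(i < n) c (bump p i) *: nth 0 (subsample X n (bump p) w) i.
Proof.
move=> pn; rewrite /lincomb (bigD1_ord (Ordinal pn))//=; congr (_ + _).
by apply: eq_bigr => i _; rewrite (nth_map i) ?size_enum_ord// nth_ord_enum.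
Qed.

Lemma measurable_lincomb (R : realType) (d : measure_display)
    (T : measurableType d) (P : probability T R)
    (X : nat -> {RV P >-> (R * R)%type}) (m : nat) (c : nat -> R) :
  measurable_fun setT (lincomb X m c).
Proof.
apply: (measurable_pair_sum (f := fun i w => c i *: X i w)) => i _.
by apply: measurable_pairZ; exact: measurable_funPT.
Qed.

(** Given the other increments, [X q] has to hit one prescribed point, and a point is contained in a
    line. *)
Lemma lincomb_null (R : realType) (d : measure_display) (T : measurableType d)
    (P : probability T R) (X : nat -> {RV P >-> (R * R)%type}) (n q : nat)
    (c : nat -> R) :
  iid X ->
  (forall h : set (R * R), affine_line h -> P (X 0%N @^-1` h) = 0%E) ->
  (q < n.+1)%N -> c q != 0 ->
  P [set w | lincomb X n.+1 c w = 0] = 0%E.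
Proof.
move=> iidX hline qn cq.
pose C (t : n.-tuple (R * R)) := \sum_(i < n) c (bump q i) *: nth 0 t i.
have mC : measurable_fun setT C.
  exact: (@measurable_tuple_lincomb R n n (fun i => c (bump q i))).
pose F (tx : n.-tuple (R * R) * (R * R)) := c q *: tx.2 + C tx.1.
have mF : measurable_fun setT F.
  apply: measurable_pairD; first exact: measurable_pairZ.
  exact: measurableT_comp.
have -> : [set w | lincomb X n.+1 c w = 0] =
    [set w | F (subsample X n (bump q) w, X q w) = 0].
  by apply/seteqP; split => w /=; rewrite (lincomb_subsample _ _ _ qn).
apply: (independent_null (N := [set tx | F tx = 0])) => //.
- by move=> i j _ _; exact: (can_inj (bumpK _)).
- by move=> i _; rewrite eq_sym neq_bump.
- exact: measurable_pair_eq0.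
move=> t /=.
have -> : X 0%N @^-1` [set x | F (t, x) = 0] =
    X 0%N @^-1` [set - (c q)^-1 *: C t].
  apply/seteqP; split => w /=; rewrite /F /=.
    move=> /eqP; rewrite addr_eq0 => /eqP e.
    by rewrite scaleNr -scalerN -e scalerA mulVf// scale1r.
  by move=> ->; rewrite scalerA mulrN divff// scaleN1r addNr.
set p := - (c q)^-1 *: C t.
(* Any direction would do for a line through the point [p]. *)
have e1 : ((1, 0) : R * R) != 0 by rewrite -pair_eqE /= oner_eq0.
have hp := hline _ (affine_line_cross p e1).
have mline : measurable [set x : R * R | cross (1, 0) (x - p) = 0].
  apply: measurable_eq0; apply: measurable_cross => //.
  exact: measurable_pairB.
apply/eqP; rewrite eq_le measure_ge0 andbT -hp.
apply: le_measure; rewrite ?inE.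
- have -> : [set p] = [set x | x - p = 0].
    apply/seteqP; split => x /=; first by move=> ->; rewrite subrr.
    by move/eqP; rewrite subr_eq0 => /eqP.
  apply: measurable_funPTI; apply: measurable_pair_eq0.
  exact: measurable_pairB.
- exact: measurable_funPTI.
- by move=> w /= ->; rewrite subrr cross0r.
Qed.

(** The nonzero minor makes [c] and [e] linearly independent. Subtracting a multiple of the first
    combination from the second removes [X p] from it without changing the cross product. What
    remains is almost surely nonzero and, given the other increments, [X p] must then lie on a line
    in its direction. *)
Lemma cross_lincomb_negligible (R : realType) (d : measure_display)
    (T : measurableType d) (P : probability T R)
    (X : nat -> {RV P >-> (R * R)%type}) (n p q : nat) (c e : nat -> R) :
  iid X ->
  (forall h : set (R * R), affine_line h -> P (X 0%N @^-1` h) = 0%E) ->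
  (p < n.+1)%N -> (q < n.+1)%N -> c p * e q - c q * e p != 0 ->
  P.-negligible [set w | cross (lincomb X n.+1 c w) (lincomb X n.+1 e w) = 0].
Proof.
(* Exchanging [p] and [q] only changes the sign of the minor, and [c p] and [c q] cannot both
   vanish. *)
move=> iidX hline; wlog cp : p q / c p != 0 => [wl pn qn|pn qn] cepq.
  have [cp0|cp] := eqVneq (c p) 0; last exact: (wl p q).
  have [cq0|cq] := eqVneq (c q) 0.
    by move: cepq; rewrite cp0 cq0 !mul0r subrr eqxx.
  by apply: (wl q p) => //; rewrite -opprB oppr_eq0.
pose f i := e i - e p / c p * c i.
have fp : f p = 0 by rewrite /f divfK// subrr.
have fq : f q != 0.
  apply: contra cepq => /eqP; rewrite /f => h.
  apply/eqP; transitivity (c p * (e q - e p / c p * c q)); first by field.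
  by rewrite h mulr0.
have fE w : lincomb X n.+1 f w =
    lincomb X n.+1 e w - (e p / c p) *: lincomb X n.+1 c w.
  rewrite /lincomb scaler_sumr -sumrB; apply: eq_bigr => i _.
  by rewrite scalerA -scalerBl.
have crossE w : cross (lincomb X n.+1 c w) (lincomb X n.+1 e w) =
    - cross (lincomb X n.+1 f w) (lincomb X n.+1 c w).
  by rewrite fE -crossC; move: (lincomb X _ _ w) (lincomb X _ _ w) => u v;
    rewrite /cross /= /GRing.scale /=; ring.
pose C (t : n.-tuple (R * R)) := \sum_(i < n) c (bump p i) *: nth 0 t i.
pose F (t : n.-tuple (R * R)) := \sum_(i < n) f (bump p i) *: nth 0 t i.
have mS a : measurable_fun setT
    (fun t : n.-tuple (R * R) => \sum_(i < n) a (bump p i) *: nth 0 t i).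
  exact: (@measurable_tuple_lincomb R n n (fun i => a (bump p i))).
have CE w : lincomb X n.+1 c w = c p *: X p w + C (subsample X n (bump p) w).
  exact: lincomb_subsample.
have FE w : lincomb X n.+1 f w = F (subsample X n (bump p) w).
  by rewrite (lincomb_subsample _ _ _ pn) fp scale0r add0r.
(* Requiring [F <> 0] makes each section of [N] empty or a line; the exceptional event [F = 0] is
   left to [lincomb_null]. *)
pose N := [set tx : n.-tuple (R * R) * (R * R) |
  F tx.1 <> 0 /\ cross (F tx.1) (c p *: tx.2 + C tx.1) = 0].
have mN : measurable N.
  apply: measurableI.
    apply: measurableC; apply: (measurable_pair_eq0 (f := fun tx => F tx.1)).
    by apply: measurableT_comp => //; exact: mS.
  apply: measurable_eq0; apply: measurable_cross.
    by apply: measurableT_comp => //; exact: mS.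
  apply: measurable_pairD; first exact: measurable_pairZ.
  by apply: measurableT_comp => //; exact: mS.
have N0 : P [set w | N (subsample X n (bump p) w, X p w)] = 0%E.
  apply: independent_null => //.
  - by move=> i j _ _; exact: (can_inj (bumpK _)).
  - by move=> i _; rewrite eq_sym neq_bump.
  move=> t; have [F0|/eqP F0] := eqVneq (F t) 0.
    rewrite [X in P X](_ : _ = set0) ?measure0//.
    by apply/seteqP; split => w // [].
  have /eqP F0' := F0.
  rewrite -[RHS](hline _ (affine_line_cross (- (c p)^-1 *: C t) F0')).
  congr (P _); apply/seteqP; split => w /=; rewrite /N /=.
    move=> [_] h; rewrite scaleNr opprK.
    apply: (mulfI cp); rewrite mulr0 -[RHS]h.
    by rewrite /cross /= /GRing.scale /=; field.
  rewrite scaleNr opprK => h; split => //.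
  transitivity (c p * cross (F t) (X 0%N w + (c p)^-1 *: C t)).
    by rewrite /cross /= /GRing.scale /=; field.
  by rewrite h mulr0.
have f0 := lincomb_null iidX hline qn fq.
have mX a : measurable_fun setT (lincomb X n.+1 a) by exact: measurable_lincomb.
have mN' : measurable [set w | N (subsample X n (bump p) w, X p w)].
  rewrite -[X in measurable X]setTI.
  have mZX : measurable_fun setT (fun w => (subsample X n (bump p) w, X p w)).
    apply: measurable_fun_pair; first exact: measurable_subsample.
    exact: measurable_funPT.
  exact: mZX.
apply: (@negligibleS _ _ _ _ ([set w | lincomb X n.+1 f w = 0] `|`
    [set w | N (subsample X n (bump p) w, X p w)])).
  move=> w /=; rewrite crossE => /eqP; rewrite oppr_eq0 => /eqP h.
  have [l0|/eqP l0] := eqVneq (lincomb X n.+1 f w) 0; [by left|right].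
  by rewrite /N /= -FE -CE.
apply: negligibleU.
  exists [set w | lincomb X n.+1 f w = 0]; split => //.
  exact: measurable_pair_eq0.
by exists [set w | N (subsample X n (bump p) w, X p w)]; split.
Qed.

Lemma walk_lincomb (R : realType) (d : measure_display)
    (T : measurableType d) (P : probability T R)
    (X : nat -> {RV P >-> (R * R)%type}) (m k : nat) (w : T) : (k <= m)%N ->
  walk X k w = lincomb X m (fun i => (i < k)%:R) w.
Proof.
move=> km; rewrite /walk /lincomb (big_ord_widen m (fun i => X i w))//.
rewrite big_mkcond.
by apply: eq_bigr => i _; case: ifP => _; rewrite ?scale1r ?scale0r.
Qed.

(** Taking [theta j = j / (n + 1)] gives the difference bridge, and [theta = 0] the walk. Each cross
    product involved is one of two linear combinations of the increments, so it is enough to find a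
    nonzero minor of their coefficients. *)
Lemma general_position_negligible (R : realType) (d : measure_display)
    (T : measurableType d) (P : probability T R)
    (X : nat -> {RV P >-> (R * R)%type}) (n : nat) (theta : nat -> R) :
  iid X ->
  (forall h : set (R * R), affine_line h -> P (X 0%N @^-1` h) = 0%E) ->
  (forall k, (k < n.+1)%N -> theta k != 1) ->
  (forall k i j, (0 < k <= i)%N -> (i < j < n.+1)%N -> theta k = 0 ->
    theta j - theta i != 1) ->
  P.-negligible [set w | ~ general_position n.+1
    (fun j => walk X j w - theta j *: walk X n.+1 w)].
Proof.
move=> iidX hline th1 th0.
pose cf j i : R := (i < j)%:R - theta j.
have sE j w : (j < n.+1)%N ->
    walk X j w - theta j *: walk X n.+1 w = lincomb X n.+1 (cf j) w.
  move=> jn; rewrite (walk_lincomb _ _ (ltnW jn)) (walk_lincomb _ _ (leqnn _)).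
  rewrite /lincomb scaler_sumr -sumrB; apply: eq_bigr => i _.
  by rewrite /cf ltn_ord scale1r -scalerBl.
pose F k i j := [set w | [/\ (0 < k < n.+1)%N, (i < j < n.+1)%N,
  (j < k)%N || (k <= i)%N &
  cross (lincomb X n.+1 (cf k) w)
        (lincomb X n.+1 (fun l => cf j l - cf i l) w) = 0]].
apply: (@negligibleS _ _ _ _ (\bigcup_k \bigcup_i \bigcup_j F k i j)).
  move=> w; apply: contra_notP => nF k i j k0 ij jki km.
  rewrite !sE//; [|lia..]; apply/eqP => c0; apply: nF.
  exists k => //; exists i => //; exists j => //; split => //; first by lia.
  rewrite -c0; congr cross; rewrite /lincomb -sumrB.
  by apply: eq_bigr => l _; rewrite scalerBl.
apply: negligible_bigcup => k; apply: negligible_bigcup => i.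
apply: negligible_bigcup => j.
have [[km ij jki]|h] := pselect [/\ (0 < k < n.+1)%N, (i < j < n.+1)%N &
    (j < k)%N || (k <= i)%N]; last first.
  by apply: negligibleS (negligible_set0 P) => w [? ? ? _]; apply: h; split.
apply: (@negligibleS _ _ _ _ [set w | cross (lincomb X n.+1 (cf k) w)
  (lincomb X n.+1 (fun l => cf j l - cf i l) w) = 0]); first by move=> w [].
have eij : (i < j)%N = true by lia.
have eji : (j < i)%N = false by lia.
(* With truth values read as 0 or 1, the coefficients in column [l] are [(l < k) - theta k] and
   [(i <= l < j) - (theta j - theta i)]. Columns [i] and [j] give the minor [theta k - 1] if
   [j < k], and [theta k] if [k <= i]; where the latter vanishes, columns [i] and 0 give
   [theta j - theta i - 1]. *)
have [jk|kj] := ltnP j k.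
  apply: (@cross_lincomb_negligible _ _ _ _ _ _ i j) => //; [lia..|].
  have eik : (i < k)%N = true by lia.
  rewrite /cf !ltnn eij eji eik jk /=.
  have kn : (k < n.+1)%N by lia.
  apply: contra (th1 k kn) => /eqP e; apply/eqP; lra.
have ki : (k <= i)%N by lia.
have eik : (i < k)%N = false by lia.
have ejk : (j < k)%N = false by lia.
have [tk|tk] := eqVneq (theta k) 0.
  apply: (@cross_lincomb_negligible _ _ _ _ _ _ i 0%N) => //; [lia..|].
  have e0k : (0 < k)%N = true by lia.
  have e0 : (0 < j)%N = true by lia.
  have e0i : (0 < i)%N = true by lia.
  rewrite /cf !ltnn eij e0k e0 e0i eik tk /=.
  have h1 : (0 < k <= i)%N by lia.
  have h2 : (i < j < n.+1)%N by lia.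
  apply: contra (th0 k i j h1 h2 tk) => /eqP e; apply/eqP; lra.
apply: (@cross_lincomb_negligible _ _ _ _ _ _ i j) => //; [lia..|].
rewrite /cf !ltnn eij eji eik ejk /=.
apply: contra tk => /eqP e; apply/eqP; lra.
Qed.

(** * Difference bridges *)

Lemma measure_ae_eq (R : realType) (d : measure_display) (T : measurableType d)
    (mu : {measure set T -> \bar R}) (N A B : set T) :
  measurable A -> measurable B -> mu.-negligible N ->
  (forall w, ~ N w -> A w <-> B w) -> mu A = mu B.
Proof.
move=> mA mB [M [mM M0 NM]] AB.
have split_off C : measurable C -> mu C = mu (C `\` M).
  move=> mC; rewrite -[in LHS](setDUK (A := C `&` M) (B := C)); last first.
    exact: subIsetl.
  rewrite setUC setDIr setDv set0U measureU0//.
  - exact: measurableD.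
  - exact: measurableI.
  by apply: (subset_measure0 _ _ _ M0) => //; exact: measurableI.
rewrite split_off// (split_off B)//; congr (mu _).
apply/seteqP; split => w [h nM]; split => //.
  by apply/(AB w) => // /NM.
by apply/(AB w) => // /NM.
Qed.

Lemma measure_ae_partition (R : realType) (d : measure_display)
    (T : measurableType d) (mu : {measure set T -> \bar R}) (I : finType)
    (C : set T) (F : I -> set T) :
  measurable C -> (forall i, measurable (F i)) ->
  (forall i j w, F i w -> F j w -> i = j) ->
  mu.-negligible [set w | forall i, ~ F i w] ->
  mu C = (\sum_(i : I) mu (F i `&` C))%E.
Proof.
move=> mC mF F_inj neg.
have mU : measurable (\bigcup_(i in [set: I]) (F i `&` C)).
  by apply: fin_bigcup_measurable => // i _; exact: measurableI.
have -> : mu C = mu (\bigcup_(i in [set: I]) (F i `&` C)).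
  apply: measure_ae_eq neg _ => // w /= /existsNP[i /contrapT Fi].
  by split => [Cw|[j _ []]//]; exists i.
rewrite measure_fin_bigcup//.
- rewrite (fsbigE (index_enum I))//; last 2 first.
  + exact: index_enum_uniq.
  + by move=> i _; rewrite mem_index_enum.
  by apply: eq_bigl => i; rewrite in_setT.
- exact: finite_finset.
- move=> i j _ _ [w [[Fi _] [Fj _]]]; exact: F_inj Fi Fj.
- by move=> i _; exact: measurableI.
Qed.

Lemma lowest_ext (R : realType) (e : R) (m k a b : nat) (s s' : nat -> R * R) :
  (k < m)%N -> (a < m)%N -> (b < m)%N -> (forall j, (j < m)%N -> s j = s' j) ->
  lowest e m k a b s -> lowest e m k a b s'.
Proof.
by move=> km am bm ss' h j jm; rewrite -!ss'//; exact: h.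
Qed.

Lemma walk_subsample (R : realType) (d : measure_display)
    (T : measurableType d) (P : probability T R)
    (X : nat -> {RV P >-> (R * R)%type}) (m k : nat) (rho : nat -> nat)
    (w : T) :
  (k <= m)%N ->
  walk (fun i (t : m.-tuple (R * R)) => nth 0 t i) k (subsample X m rho w) =
  walk (fun i => X (rho i)) k w.
Proof.
move=> km; apply: eq_bigr => i _.
have im : (i < m)%N by exact: leq_trans km.
by rewrite (nth_map (Ordinal im)) ?size_enum_ord// nth_enum_ord.
Qed.

Lemma measurable_walk (R : realType) (d : measure_display)
    (T : measurableType d) (X : nat -> T -> R * R) (k : nat) :
  (forall i, (i < k)%N -> measurable_fun setT (X i)) ->
  measurable_fun setT (walk X k).
Proof. exact: measurable_pair_sum. Qed.

Lemma measurable_difference_bridge (R : realType) (d : measure_display)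
    (T : measurableType d) (X : nat -> T -> R * R) (n k : nat) :
  (k <= n.+1)%N -> (forall i, (i < n.+1)%N -> measurable_fun setT (X i)) ->
  measurable_fun setT (difference_bridge X n k).
Proof.
move=> kn mX; apply: measurable_pairB.
  by apply: measurable_walk => i ik; apply: mX; lia.
by apply: measurable_pairZ; exact: measurable_walk.
Qed.

(** The swapped bridge is the bridge of the permuted increments, whose joint law is the same by
    [exchangeable]. Their total is unchanged, so any condition [B] on it may be carried along. *)
Lemma lowest_swap_probability (R : realType) (d : measure_display)
    (T : measurableType d) (P : probability T R)
    (X : nat -> {RV P >-> (R * R)%type}) (n p q r k a b : nat)
    (B : set (R * R)) :
  iid X -> (p <= q <= r)%N -> (r <= n.+1)%N ->
  (k < n.+1)%N -> (a < n.+1)%N -> (b < n.+1)%N -> measurable B ->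
  P [set w | lowest 0 n.+1 k a b
               (swap_path p q r (fun j => difference_bridge X n j w)) /\
             B (walk X n.+1 w)] =
  P [set w | lowest 0 n.+1 k a b (fun j => difference_bridge X n j w) /\
             B (walk X n.+1 w)].
Proof.
move=> iidX pqr rn kn an bn mB.
(* The event is transported to the space of tuples of increments, with coordinates [Y], where
   exchangeability is stated. *)
pose Y i (t : n.+1.-tuple (R * R)) : R * R := nth 0 t i.
have mY i : measurable_fun setT (Y i) by exact: measurable_coordinate.
pose A := [set t | lowest 0 n.+1 k a b (fun j => difference_bridge Y n j t) /\
                   B (walk Y n.+1 t)].
have mA : measurable A.
  apply: measurableI.
    apply: (@measurable_lowest R _ _ 0 n.+1 k a b
      (fun t j => difference_bridge Y n j t)) => //.
    by move=> i im; apply: measurable_difference_bridge => //; exact: ltnW.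
  rewrite -[X in measurable X]setTI.
  by apply: (measurable_walk (X := Y)) => // i _; exact: mY.
have AE rho : subsample X n.+1 rho @^-1` A =
    [set w | lowest 0 n.+1 k a b
               (fun j => difference_bridge (fun i => X (rho i)) n j w) /\
             B (walk (fun i => X (rho i)) n.+1 w)].
  have wE j w : (j <= n.+1)%N ->
      walk Y j (subsample X n.+1 rho w) = walk (fun i => X (rho i)) j w.
    exact: walk_subsample.
  have dE j w : (j < n.+1)%N ->
      difference_bridge Y n j (subsample X n.+1 rho w) =
      difference_bridge (fun i => X (rho i)) n j w.
    by move=> jn; rewrite /difference_bridge !wE// ltnW.
  apply/seteqP; split => w [h hB]; (split; last by move: hB; rewrite -wE).
    by apply: lowest_ext h => // j jn; rewrite -dE.
  by apply: lowest_ext h => // j jn; rewrite -dE.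
have := exchangeable iidX
  (fun i j _ _ => swap_index_inj pqr (x1 := i) (x2 := j)) mA.
pose Z i : T -> R * R := X i.
have wE w : walk (fun i => X (swap_index p q r i)) n.+1 w = walk X n.+1 w.
  by rewrite (walk_swap Z)// swap_path_last.
have dE w :
    (fun j => difference_bridge (fun i => X (swap_index p q r i)) n j w) =
    swap_path p q r (fun j => difference_bridge X n j w).
  by apply/funext => j; rewrite (difference_bridge_swap Z).
by rewrite !AE => <-; congr (P _); apply/seteqP; split => w /=; rewrite wE dE.
Qed.

(** A rotation of the first block moves [a] to 0, and one of the last block moves [b] to [k]. *)
Lemma lowest_probability_inv (R : realType) (d : measure_display)
    (T : measurableType d) (P : probability T R)
    (X : nat -> {RV P >-> (R * R)%type}) (n k a b : nat) (B : set (R * R)) :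
  iid X -> (a < k)%N -> (k <= b < n.+1)%N -> measurable B ->
  P [set w | lowest 0 n.+1 k a b (fun j => difference_bridge X n j w) /\
             B (walk X n.+1 w)] =
  P [set w | lowest 0 n.+1 k 0 k (fun j => difference_bridge X n j w) /\
             B (walk X n.+1 w)].
Proof.
move=> iidX ak kb mB.
have D0 w : difference_bridge X n 0 w = 0.
  by rewrite /difference_bridge walk0 mul0r scale0r subr0.
have Dm w : difference_bridge X n n.+1 w = 0.
  by rewrite /difference_bridge divff ?pnatr_eq0// scale1r subrr.
transitivity (P [set w | lowest 0 n.+1 k 0 b
    (fun j => difference_bridge X n j w) /\ B (walk X n.+1 w)]).
  rewrite -(lowest_swap_probability (p := 0) (q := a) (r := k)
    (k := k) (a := 0) (b := b))//; [|lia..].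
  have h w : lowest 0 n.+1 k 0 b
      (swap_path 0 a k (fun j => difference_bridge X n j w)) <->
      lowest 0 n.+1 k a b (fun j => difference_bridge X n j w).
    by apply: lowest_swapl => //; lia.
  by congr (P _); apply/seteqP; split => w [hw ?]; split => //; exact/h.
rewrite -(lowest_swap_probability (p := k) (q := b) (r := n.+1)
  (k := k) (a := 0) (b := k))//; [|lia..].
have h w : lowest 0 n.+1 k 0 k
    (swap_path k b n.+1 (fun j => difference_bridge X n j w)) <->
    lowest 0 n.+1 k 0 b (fun j => difference_bridge X n j w).
  by apply: lowest_swapr => //; lia.
by congr (P _); apply/seteqP; split => w [hw ?]; split => //; exact/h.
Qed.

(** In general position exactly one pair of lowest indices exists; its second member is recorded by
    the offset from [k]. The measure is arbitrary because both [P] and the conditional law get cut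
    up in this way. *)
Lemma lowest_partition (R : realType) (d : measure_display)
    (T : measurableType d) (mu : {measure set T -> \bar R})
    (s : T -> nat -> R * R) (m k : nat) (C : set T) :
  (0 < k < m)%N -> measurable C ->
  (forall j, (j < m)%N -> measurable_fun setT (s ^~ j)) ->
  mu.-negligible [set w | ~ general_position m (s w)] ->
  mu C = (\sum_(i : 'I_k * 'I_(m - k))
    mu ([set w | lowest 0 m k i.1 (k + i.2) (s w)] `&` C))%E.
Proof.
move=> km mC ms gp.
have hi (i : 'I_k * 'I_(m - k)) : (i.1 < k)%N /\ (k <= k + i.2 < m)%N.
  by case: i => -[i ik] [j jk] /=; lia.
apply: (measure_ae_partition (F := fun i : 'I_k * 'I_(m - k) =>
  [set w | lowest 0 m k i.1 (k + i.2) (s w)])) => //.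
- by move=> i; have [] := hi i => h1 h2; apply: measurable_lowest => //; lia.
- move=> i j w li lj; have [i1 i2] := hi i; have [j1 j2] := hi j.
  have km' : (k < m)%N by lia.
  have [/ord_inj e1 /addnI/ord_inj e2] := lowest_inj km' i1 i2 j1 j2 li lj.
  by rewrite (surjective_pairing i) e1 e2 -surjective_pairing.
apply: negligibleS gp => w /= nl gp.
have [a [b [ak kb lab]]] := exists_lowest km gp.
have bk : (b - k < m - k)%N by lia.
apply: (nl (Ordinal ak, Ordinal bk)) => /=.
by rewrite subnKC//; lia.
Qed.

(** Outside a negligible set the event is the union of the events on the right, pairwise disjoint by
    [lowest_index_inj]; the ordinal [i] stands for [k = i + 1]. *)
Lemma conv_hull0_probability (R : realType) (d : measure_display)
    (T : measurableType d) (mu : {measure set T -> \bar R})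
    (s : T -> nat -> R * R) (n : nat) :
  (2 <= n)%N -> (forall w, s w 0%N = 0) ->
  (forall j, (j < n.+1)%N -> measurable_fun setT (s ^~ j)) ->
  mu.-negligible [set w | ~ general_position n.+1 (s w)] ->
  mu [set w | ~ conv_hull [set s w k | k in [set k | (1 <= k <= n)%N]] 0] =
  (\sum_(i < n) mu [set w | lowest 0 n.+1 i.+1 0 i.+1 (s w)])%E.
Proof.
move=> n2 s0 ms gp.
set C := [set w | _].
have mC : measurable C.
  (* Measurability comes from [conv_hull0P], which holds at every point, not only in general
     position. *)
  have -> : C = \bigcup_(k in [set k | (1 <= k <= n)%N])
      [set w | forall j, (j < n.+1)%N -> (0 < j)%N -> ccw (s w k) (s w j)].
    apply/seteqP; split => w.
      move=> /(conv_hull0P (s w) (ltnW n2))[k hk h]; exists k => // j jn j0.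
      by apply: h; lia.
    move=> [k hk h]; apply/(conv_hull0P (s w) (ltnW n2)); exists k => // j hj.
    by apply: h; lia.
  apply: bigcup_measurable => k /= hk.
  apply: measurable_forall_lt => j jn; apply: measurable_imply => j0.
  apply: measurableU.
    by apply: measurable_lt0; apply: measurable_cross; apply: ms; lia.
  apply: measurableI.
    by apply: measurable_eq0; apply: measurable_cross; apply: ms; lia.
  by apply: measurable_lt0; apply: measurable_inner; apply: ms; lia.
pose F (i : 'I_n) := [set w | lowest 0 n.+1 i.+1 0 i.+1 (s w)].
have mF i : measurable (F i).
  by case: i => i ni; apply: measurable_lowest => //=; lia.
pose U := \bigcup_(i in [set: 'I_n]) F i.
have mU : measurable U by exact: fin_bigcup_measurable.
transitivity (mu U).
  apply: measure_ae_eq gp _ => // w /contrapT gpw.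
  split.
    move=> /(conv_hull0_lowest n2 (s0 w) gpw)[k hk lk].
    have kn : (k.-1 < n)%N by lia.
    exists (Ordinal kn) => //; rewrite /F /= prednK//; lia.
  move=> [[i ni] _ li]; apply/(conv_hull0_lowest n2 (s0 w) gpw).
  by exists i.+1.
rewrite measure_fin_bigcup//.
- rewrite (fsbigE (index_enum _))//; last 2 first.
  + exact: index_enum_uniq.
  + by move=> i _; rewrite mem_index_enum.
  by apply: eq_bigl => i; rewrite in_setT.
- exact: finite_finset.
- move=> [i ni] [j nj] _ _ [w [li lj]]; apply/val_inj => /=.
  by apply: succn_inj; exact: (lowest_index_inj (s0 w) _ _ li lj).
Qed.

Lemma sum_const_EFin (R : realType) (I : finType) (f : I -> \bar R) (x : R) :
  (forall i, f i = x%:E) -> (\sum_(i : I) f i = (x *+ #|I|)%:E)%E.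
Proof.
move=> fx; rewrite (eq_bigr (fun=> x%:E)); last by move=> i _; exact: fx.
by rewrite sumEFin sumr_const.
Qed.

Lemma measurable_near0 (R : realType) (d : measure_display)
    (T : measurableType d) (f : T -> R * R) (r : R) :
  measurable_fun setT f -> measurable [set w | euclidean_norm (f w) <= r].
Proof.
move=> mf.
have -> : [set w | euclidean_norm (f w) <= r] =
    ~` [set w | 0 < euclidean_norm (f w) - r].
  by apply/seteqP; split => w /=; rewrite subr_gt0 leNgt => /negP.
apply: measurableC; apply: measurable_lt0; apply: measurable_funB => //.
have msqrt : measurable_fun setT (@Num.sqrt R).
  by apply: continuous_measurable_fun; exact: sqrt_continuous.
apply: (measurableT_comp msqrt) => /=.
by apply: measurable_funD; apply: measurable_funX; apply: measurableT_comp.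
Qed.

Lemma difference_bridge_general_position (R : realType) (d : measure_display)
    (T : measurableType d) (P : probability T R)
    (X : nat -> {RV P >-> (R * R)%type}) (n : nat) :
  iid X ->
  (forall h : set (R * R), affine_line h -> P (X 0%N @^-1` h) = 0%E) ->
  P.-negligible [set w | ~ general_position n.+1
    (fun j => difference_bridge X n j w)].
Proof.
move=> iidX hline; apply: general_position_negligible => // [k kn|k i j ki _].
  apply/eqP => h; have : k%:R = n.+1%:R :> R.
    by rewrite -[RHS]mul1r -[X in _ = X * _]h divfK// pnatr_eq0.
  by move/eqP; rewrite eqr_nat; lia.
(* Here [theta k = 0] would force [k = 0], so the second condition holds vacuously. *)
by move/eqP; rewrite mulf_eq0 invr_eq0 !pnatr_eq0 orbF => /eqP; lia.
Qed.

(** The [k (n + 1 - k)] positions of the lowest indices are equally likely by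
    [lowest_probability_inv] and, up to a null set, partition the event that the total lies in [B].
    Allowing [B] yields the formula conditionally on the total. *)
Lemma lowest_probability (R : realType) (d : measure_display)
    (T : measurableType d) (P : probability T R)
    (X : nat -> {RV P >-> (R * R)%type}) (n k a b : nat) (B : set (R * R)) :
  iid X ->
  (forall h : set (R * R), affine_line h -> P (X 0%N @^-1` h) = 0%E) ->
  (a < k)%N -> (k <= b < n.+1)%N -> measurable B ->
  P [set w | lowest 0 n.+1 k a b (fun j => difference_bridge X n j w) /\
             B (walk X n.+1 w)] =
  (fine (P [set w | B (walk X n.+1 w)]) / (k * (n.+1 - k))%:R)%:E.
Proof.
move=> iidX hline ak kb mB; rewrite lowest_probability_inv//.
have mC : measurable [set w | B (walk X n.+1 w)].
  rewrite -[X in measurable X]setTI.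
  by apply: (measurable_walk (X := fun i => X i)) => // i _;
    exact: measurable_funPT.
have mD j : (j < n.+1)%N -> measurable_fun setT (difference_bridge X n j).
  move=> jn; apply: measurable_difference_bridge; first exact: ltnW.
  by move=> i _; exact: measurable_funPT.
have mE : measurable [set w |
    lowest 0 n.+1 k 0 k (fun j => difference_bridge X n j w) /\
    B (walk X n.+1 w)].
  apply: measurableI => //.
  by apply: (@measurable_lowest R _ _ 0 n.+1 k 0 k
    (fun w j => difference_bridge X n j w)) => //; lia.
have km : (0 < k < n.+1)%N by lia.
have := lowest_partition (s := fun w j => difference_bridge X n j w) km mC mD
  (difference_bridge_general_position n iidX hline).
rewrite (sum_const_EFin (x := fine (P [set w |
    lowest 0 n.+1 k 0 k (fun j => difference_bridge X n j w) /\
    B (walk X n.+1 w)]))); last first.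
  move=> [[i ik] [j jk]] /=; rewrite fineK ?fin_num_measure//.
  by rewrite -(lowest_probability_inv (a := i) (b := k + j))//; lia.
move=> ->; rewrite /= card_prod !card_ord -[X in X / _]mulr_natr mulfK.
  by rewrite fineK// fin_num_measure.
by rewrite pnatr_eq0 muln_eq0; lia.
Qed.

Lemma bridge_sumE (R : realType) (n : nat) :
  (\sum_(i < n) (1 / (i.+1 * (n.+1 - i.+1))%:R)%:E =
   (\sum_(1 <= k < n.+1) 1 / (k * (n - k + 1))%:R : R)%:E)%E.
Proof.
rewrite sumEFin big_add1 big_mkord; congr EFin; apply: eq_bigr => i _.
by have -> : (n.+1 - i.+1 = n - i.+1 + 1)%N by have := ltn_ord i; lia.
Qed.

Lemma difference_bridge_probability (R : realType) (d : measure_display)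
    (T : measurableType d) (P : probability T R)
    (X : nat -> {RV P >-> (R * R)%type}) (n : nat) :
  (2 <= n)%N -> iid X ->
  (forall h : set (R * R), affine_line h -> P (X 0%N @^-1` h) = 0%E) ->
  P [set w | ~ conv_hull
       [set difference_bridge X n k w | k in [set k : nat | (1 <= k <= n)%N]] 0]
  = (\sum_(1 <= k < n.+1) 1 / (k * (n - k + 1))%:R)%:E.
Proof.
move=> n2 iidX hline.
rewrite (@conv_hull0_probability _ _ _ P
  (fun w j => difference_bridge X n j w))//.
- rewrite -bridge_sumE; apply: eq_bigr => -[i ni] _ /=.
  have := @lowest_probability _ _ _ P X n i.+1 0 i.+1 setT iidX hline.
  have hi : (i.+1 <= i.+1 < n.+1)%N by rewrite leqnn ltnS.
  move=> /(_ (ltn0Sn i) hi measurableT).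
  rewrite (_ : [set w | _ /\ [set: R * R] _] = [set w |
    lowest 0 n.+1 i.+1 0 i.+1 (fun j => difference_bridge X n j w)]);
    last first.
    by apply/seteqP; split => w //= [].
  by move=> ->; rewrite (_ : [set w | _] = setT) ?probability_setT.
- by move=> w; rewrite /difference_bridge walk0 mul0r scale0r subr0.
- move=> j jn; apply: measurable_difference_bridge; first exact: ltnW.
  by move=> i _; exact: measurable_funPT.
- exact: difference_bridge_general_position.
Qed.

(** * Conditional bridges *)

Lemma margin_le (R : realType) (e e' : R) (u v : R * R) :
  e <= e' -> margin e' u v <= margin e u v.
Proof. by move=> ee'; rewrite lerB// ler_wpM2r// !addr_ge0. Qed.

(** The term in [cross z z] vanishes, so the change is linear in [z]: four products, each at most
    [e] times the absolute value of a coordinate of [u] or [v]. *)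
Lemma margin_perturb (R : realType) (e g g' : R) (u v z : R * R) :
  euclidean_norm z <= e -> 0 <= g <= 1 -> `|g'| <= 1 -> 0 < margin e u v ->
  0 < margin 0 (u - g *: z) (v - g' *: z).
Proof.
move=> ze /andP[g0 g1] g'1; rewrite margin0 /margin subr_gt0 => uv.
have sqrt_le (x y : R) : `|x| <= Num.sqrt (x ^+ 2 + y ^+ 2).
  by rewrite -sqrtr_sqr ler_wsqrtr// lerDl sqr_ge0.
have z1 : `|z.1| <= e by apply: le_trans ze; exact: sqrt_le.
have z2 : `|z.2| <= e.
  by apply: le_trans ze; rewrite /euclidean_norm addrC; exact: sqrt_le.
have gn : `|g| <= 1 by rewrite ger0_norm.
have bound (s x y : R) : `|s| <= 1 -> `|y| <= e -> `|s * (x * y)| <= e * `|x|.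
  move=> s1 ye; rewrite !normrM mulrCA mulrC ler_wpM2r//.
  by apply: le_trans ye; rewrite ler_piMl.
have -> : cross (u - g *: z) (v - g' *: z) = cross u v -
    (g' * (u.1 * z.2) - g' * (u.2 * z.1) + (g * (v.2 * z.1) - g * (v.1 * z.2))).
  by rewrite /cross /= /GRing.scale /=; ring.
rewrite subr_gt0; apply: le_lt_trans uv.
apply: le_trans (ler_norm _) _; apply: le_trans (ler_normD _ _) _.
apply: le_trans (lerD (ler_normB _ _) (ler_normB _ _)) _.
rewrite !mulrDr.
have h1 := bound g' u.1 z.2 g'1 z2.
have h2 := bound g' u.2 z.1 g'1 z1.
have h3 := bound g v.2 z.1 gn z1.
have h4 := bound g v.1 z.2 gn z2.
by lra.
Qed.

(** The bridge at [i] is the walk minus [i / (n + 1)] times its endpoint; these coefficients lie in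
    [0, 1] and their differences in [-1, 1], as [margin_perturb] requires. *)
Lemma lowest_walk_bridge (R : realType) (T : Type) (X : nat -> T -> R * R)
    (n k a b : nat) (e : R) (w : T) :
  (a < k)%N -> (k <= b < n.+1)%N -> euclidean_norm (walk X n.+1 w) <= e ->
  lowest e n.+1 k a b (walk X ^~ w) ->
  lowest 0 n.+1 k a b (fun j => difference_bridge X n j w).
Proof.
move=> ak kb We h j jn.
have frac i : (i < n.+1)%N -> 0 <= (i%:R / n.+1%:R : R) <= 1.
  by move=> im; rewrite divr_ge0//= ler_pdivrMr ?ltr0n// mul1r ler_nat ltnW.
have dB i l : difference_bridge X n i w - difference_bridge X n l w =
    walk X i w - walk X l w -
    (i%:R / n.+1%:R - l%:R / n.+1%:R) *: walk X n.+1 w.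
  rewrite /difference_bridge scalerBl !opprB [X in _ + X = _]addrC addrACA.
    by rewrite [X in _ + X = _]addrC.
have frac2 i l : (i < n.+1)%N -> (l < n.+1)%N ->
    `|i%:R / n.+1%:R - l%:R / n.+1%:R : R| <= 1.
  move=> /frac + /frac; move: (i%:R / _) (l%:R / _) => x y.
  by move=> /andP[? ?] /andP[? ?]; rewrite ler_norml; apply/andP; split; lra.
have [h1 h2] := h j jn.
split=> jk ja; rewrite dB; apply: (margin_perturb We).
- by apply: frac; lia.
- by apply: frac2 => //; lia.
- exact: h1.
- by apply: frac; lia.
- by apply: frac2 => //; lia.
- exact: h2.
Qed.

Lemma exists_margin (R : realType) (u v : R * R) : 0 < margin 0 u v ->
  exists p : nat, forall q, (p <= q)%N -> 0 < margin (q.+1%:R^-1 : R) u v.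
Proof.
rewrite margin0 => c0; set x := `|u.1| + `|u.2| + `|v.1| + `|v.2|.
have x0 : 0 <= x by rewrite !addr_ge0.
(* The Archimedean bound gives [x / cross u v < q + 1], which is positivity of the margin for
   [1 / (q + 1)]. *)
exists (Num.bound (x / cross u v)) => q pq.
rewrite /margin subr_gt0 -/x mulrC ltr_pdivrMr ?ltr0n//.
rewrite mulrC -ltr_pdivrMr//.
apply: lt_le_trans (archi_boundP _) _; first by rewrite divr_ge0// ltW.
by rewrite ler_nat leqW.
Qed.

Lemma exists_bound_lt (m : nat) (F : nat -> nat -> Prop) :
  (forall j, (j < m)%N -> exists p, forall q, (p <= q)%N -> F j q) ->
  exists p, forall j q, (j < m)%N -> (p <= q)%N -> F j q.
Proof.
elim: m => [|m IH] h; first by exists 0%N.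
have [j jm|p hp] := IH; first by apply: h; lia.
have [p' hp'] := h m (ltnSn m).
exists (maxn p p') => j q; rewrite ltnS leq_eqVlt geq_max.
move=> /orP[/eqP->|jm] /andP[? ?].
  exact: hp'.
exact: hp.
Qed.

(** Finitely many strict inequalities admit a common room. Together with [lowest_le] this makes the
    event an increasing union, to which continuity of measure applies. *)
Lemma lowest_bigcup (R : realType) (m k a b : nat) (s : nat -> R * R) :
  lowest 0 m k a b s -> exists p : nat, lowest (p.+1%:R^-1 : R) m k a b s.
Proof.
move=> h.
have [j jm|p hp] := @exists_bound_lt m (fun j q =>
    ((j < k)%N -> j != a -> 0 < margin (q.+1%:R^-1 : R) (s k) (s j - s a)) /\
    ((k <= j)%N -> j != b -> 0 < margin (q.+1%:R^-1 : R) (s k) (s j - s b))).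
  have [h1 h2] := h j jm; have [jk|kj] := ltnP j k.
    have [->|ja] := eqVneq j a; first by exists 0%N => q _; split => // _ /eqP.
    by have [p hp] := exists_margin (h1 jk ja); exists p => q /hp ?; split.
  have [->|jb] := eqVneq j b; first by exists 0%N => q _; split => // _ /eqP.
  by have [p hp] := exists_margin (h2 kj jb); exists p => q /hp ?; split.
by exists p => j jm; exact: hp.
Qed.

Lemma lowest_le (R : realType) (e e' : R) (m k a b : nat) (s : nat -> R * R) :
  e <= e' -> lowest e' m k a b s -> lowest e m k a b s.
Proof.
move=> ee' h j jm; have [h1 h2] := h j jm.
by split => jk ja; apply: lt_le_trans (margin_le _ _ ee');
  [exact: h1|exact: h2].
Qed.

(** The entry 0 in front is the starting point S_0, so that indices agree with those of [walk]. *)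
Definition tuple_path (R : realType) (n : nat) (t : n.-tuple (R * R)) (j : nat)
    : R * R :=
  nth 0 (0 :: t) j.

Lemma measurable_tuple_path (R : realType) (n j : nat) :
  measurable_fun setT (fun t : n.-tuple (R * R) => tuple_path t j).
Proof.
case: j => [|j]; first exact: measurable_cst.
exact: (@measurable_coordinate _ (R * R)%type n 0 j).
Qed.

Lemma tuple_path_walk (R : realType) (T : Type) (X : nat -> T -> R * R)
    (n j : nat) (w : T) : (j < n.+1)%N ->
  tuple_path (walk_path X n w) j = walk X j w.
Proof.
case: j => [|j] jn; first by rewrite walk0.
have jn' : (j < n)%N := jn.
rewrite /tuple_path /walk_path /= (nth_map (Ordinal jn')) ?size_enum_ord//.
by rewrite nth_enum_ord.
Qed.

Lemma range_tnth (R : realType) (n : nat) (t : n.-tuple (R * R)) :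
  range (tnth t) = [set tuple_path t k | k in [set k | (1 <= k <= n)%N]].
Proof.
apply/seteqP; split => x /=.
  move=> [[i ni] _ <-]; exists i.+1; first by rewrite /= ni.
  by rewrite (tnth_nth 0).
move=> [[|k] //= kn <-]; exists (Ordinal kn) => //.
by rewrite (tnth_nth 0).
Qed.

Lemma measurable_walk_path (R : realType) (d : measure_display)
    (T : measurableType d) (P : probability T R)
    (X : nat -> {RV P >-> (R * R)%type}) (n : nat) :
  measurable_fun setT (walk_path X n).
Proof.
apply/measurable_fun_tnthP => i.
rewrite (_ : _ \o _ = walk X i.+1).
  by apply: (measurable_walk (X := fun i => X i)) => j _;
    exact: measurable_funPT.
by apply/funext => w /=; rewrite tnth_mktuple.
Qed.

(** Absolute continuity with respect to the law of the walk: a null event has conditional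
    probability 0 for every radius, hence also in the limit. *)
Lemma conditional_bridge_null (R : realType) (d : measure_display)
    (T : measurableType d) (P : probability T R)
    (X : nat -> {RV P >-> (R * R)%type}) (n : nat)
    (Q : probability (n.-tuple (R * R)%type) R)
    (N : set (n.-tuple (R * R))) :
  conditional_bridge_law X Q -> measurable N ->
  P (walk_path X n @^-1` N) = 0%E -> Q N = 0%E.
Proof.
move=> [_ QP] mN PN.
have mPN : measurable (walk_path X n @^-1` N).
  by rewrite -[X in measurable X]setTI; exact: measurable_walk_path.
have QN : Q N \is a fin_num by exact: fin_num_measure.
rewrite -[LHS]fineK//; congr EFin.
have := QP N mN; rewrite (_ : (fun _ => _) = cst 0).
  by move=> /(cvg_unique _ (@cvg_cst _ _ _ _ _)) => <-.
apply/funext => r /=; rewrite /cond_prob.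
rewrite (_ : P _ = 0%E) ?mul0r//.
apply: (subset_measure0 _ _ (@subIsetl _ _ _) PN) => //.
apply: measurableI => //; apply: measurable_near0.
by apply: (measurable_walk (X := fun i => X i)) => j _; exact: measurable_funPT.
Qed.

Lemma measurable_lowest_tuple_path (R : realType) (n k a b : nat) (e : R) :
  (k < n.+1)%N -> (a < n.+1)%N -> (b < n.+1)%N ->
  measurable [set t : n.-tuple (R * R) | lowest e n.+1 k a b (tuple_path t)].
Proof.
move=> kn an bn; apply: measurable_lowest => // i _.
exact: measurable_tuple_path.
Qed.

(** When the endpoint has norm at most [r <= e], a walk with room [e] has its bridge in the event
    without room. The conditional probability of the latter is known from [lowest_probability], with
    [B] the ball of radius [r], and the bound survives the limit. *)
Lemma conditional_bridge_lowest_room (R : realType) (d : measure_display)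
    (T : measurableType d) (P : probability T R)
    (X : nat -> {RV P >-> (R * R)%type}) (n k a b : nat)
    (Q : probability (n.-tuple (R * R)%type) R) (e : R) :
  iid X ->
  (forall h : set (R * R), affine_line h -> P (X 0%N @^-1` h) = 0%E) ->
  conditional_bridge_law X Q -> (a < k)%N -> (k <= b < n.+1)%N -> 0 < e ->
  (Q [set t | lowest e n.+1 k a b (tuple_path t)] <=
   (1 / (k * (n.+1 - k))%:R)%:E)%E.
Proof.
move=> iidX hline [near0_gt0 QP] ak kb e0.
set E := [set t | _].
have mE : measurable E by apply: measurable_lowest_tuple_path; lia.
have QE : Q E \is a fin_num by exact: fin_num_measure.
rewrite -[X in (X <= _)%E]fineK// lee_fin.
apply: (cvgr_to_le (QP E mE)).
near=> r.
have r0 : 0 < r by near: r; exact: nbhs_right_gt.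
have re : r <= e by near: r; exact: nbhs_right_le.
rewrite /cond_prob; set C := [set w | _].
pose B := [set z : R * R | euclidean_norm z <= r].
have mW : measurable_fun setT (walk X n.+1).
  by apply: (measurable_walk (X := fun i => X i)) => j _;
    exact: measurable_funPT.
have mB : measurable B by apply: (measurable_near0 (f := id)).
have mC : measurable C by exact: measurable_near0.
have PC : P C \is a fin_num by exact: fin_num_measure.
have PC0 : 0 < fine (P C).
  by rewrite -lte_fin fineK//; exact: near0_gt0.
rewrite ler_pdivrMr// -lee_fin mulrAC mul1r.
have mPE : measurable (walk_path X n @^-1` E).
  by rewrite -[X in measurable X]setTI; exact: measurable_walk_path.
rewrite -(lowest_probability iidX hline ak kb mB) fineK; last first.
  by apply: fin_num_measure; exact: measurableI.
apply: le_measure; rewrite ?inE.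
- exact: measurableI.
- apply: measurableI => //; apply: (@measurable_lowest R _ _ 0 n.+1 k a b
    (fun w j => difference_bridge X n j w)); [lia..|move=> i im].
  apply: measurable_difference_bridge; first exact: ltnW.
  by move=> l _; exact: measurable_funPT.
move=> w [Ew Cw]; split => //.
apply: (@lowest_walk_bridge R T (fun i => X i) n k a b e) => //.
  exact: le_trans re.
apply: lowest_ext Ew; [lia..|move=> j jn].
exact: (@tuple_path_walk R T (fun i => X i)).
Unshelve. all: by end_near. Qed.

(** Continuity from below along the rooms [1 / (p + 1)]. *)
Lemma conditional_bridge_lowest_le (R : realType) (d : measure_display)
    (T : measurableType d) (P : probability T R)
    (X : nat -> {RV P >-> (R * R)%type}) (n k a b : nat)
    (Q : probability (n.-tuple (R * R)%type) R) :
  iid X ->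
  (forall h : set (R * R), affine_line h -> P (X 0%N @^-1` h) = 0%E) ->
  conditional_bridge_law X Q -> (a < k)%N -> (k <= b < n.+1)%N ->
  (Q [set t | lowest 0 n.+1 k a b (tuple_path t)] <=
   (1 / (k * (n.+1 - k))%:R)%:E)%E.
Proof.
move=> iidX hline QP ak kb.
pose F p := [set t : n.-tuple (R * R) |
  lowest (p.+1%:R^-1 : R) n.+1 k a b (tuple_path t)].
have mF p : measurable (F p) by apply: measurable_lowest_tuple_path; lia.
have FE : [set t : n.-tuple (R * R) | lowest 0 n.+1 k a b (tuple_path t)] =
    \bigcup_p F p.
  apply/seteqP; split => t /=.
    by move=> /lowest_bigcup[p hp]; exists p.
  by move=> [p _]; apply: lowest_le; rewrite invr_ge0.
have ndF : nondecreasing_seq F.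
  move=> p q pq; apply/subsetPset => t; apply: lowest_le.
  by rewrite lef_pV2 ?posrE// ler_nat ltnS.
rewrite FE.
have cF : Q \o F @ \oo --> Q (\bigcup_p F p).
  by apply: nondecreasing_cvg_mu => //; exact: bigcupT_measurable.
apply: (cvge_to_le cF); near=> p.
apply: conditional_bridge_lowest_room iidX hline QP ak kb _.
by rewrite invr_gt0.
Unshelve. all: by end_near. Qed.

Lemma general_position_ext (R : realType) (m : nat) (s s' : nat -> R * R) :
  (forall j, (j < m)%N -> s j = s' j) -> general_position m s ->
  general_position m s'.
Proof.
move=> ss' gp k i j k0 ij jki km; rewrite -!ss'//; [exact: gp|lia..].
Qed.

(** The walk is almost surely in general position, by the case [theta = 0], and
    [conditional_bridge_null] transfers this to the limit law. *)
Lemma conditional_bridge_general_position (R : realType) (d : measure_display)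
    (T : measurableType d) (P : probability T R)
    (X : nat -> {RV P >-> (R * R)%type}) (n : nat)
    (Q : probability (n.-tuple (R * R)%type) R) :
  iid X ->
  (forall h : set (R * R), affine_line h -> P (X 0%N @^-1` h) = 0%E) ->
  conditional_bridge_law X Q ->
  Q.-negligible [set t | ~ general_position n.+1 (tuple_path t)].
Proof.
move=> iidX hline QP; set N := [set t | _].
pose F k i j := [set t : n.-tuple (R * R) | [/\ (0 < k < n.+1)%N,
  (i < j < n.+1)%N, (j < k)%N || (k <= i)%N &
  cross (tuple_path t k) (tuple_path t j - tuple_path t i) = 0]].
have mF k i j : measurable (F k i j).
  have [[h1 h2 h3]|h] := pselect [/\ (0 < k < n.+1)%N, (i < j < n.+1)%N &
      (j < k)%N || (k <= i)%N]; last first.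
    rewrite (_ : F k i j = set0)//.
    by apply/seteqP; split => t // [? ? ? _]; apply: h.
  rewrite (_ : F k i j = [set t |
    cross (tuple_path t k) (tuple_path t j - tuple_path t i) = 0]).
    apply: measurable_eq0; apply: measurable_cross.
      exact: measurable_tuple_path.
    by apply: measurable_pairB; exact: measurable_tuple_path.
  by apply/seteqP; split => t // [].
(* The countable union shows that [N] is Borel, as the passage to the limit law requires. *)
have NF : N = \bigcup_k \bigcup_i \bigcup_j F k i j.
  apply/seteqP; split => t.
    apply: contra_notP => nF k i j k0 ij jki km; apply/eqP => c0; apply: nF.
    by exists k => //; exists i => //; exists j => //; split => //; lia.
  move=> [k _ [i _ [j _ [k0 ij jki c0]]]] gp.
  have km : (k < n.+1)%N by lia.
  have k0' : (0 < k)%N by lia.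
  by have := gp k i j k0' ij jki km; rewrite c0 eqxx.
have mN : measurable N by rewrite NF; do 3! apply: bigcupT_measurable => ?.
exists N; split => //; apply: (conditional_bridge_null QP) => //.
have mPN : measurable (walk_path X n @^-1` N).
  by rewrite -[X in measurable X]setTI; exact: measurable_walk_path.
apply: measure_negligible => //.
have := @general_position_negligible _ _ _ P X n (fun=> 0) iidX hline.
have h1 k : (k < n.+1)%N -> (0 : R) != 1 by rewrite eq_sym oner_eq0.
have h2 (k i j : nat) : (0 < k <= i)%N -> (i < j < n.+1)%N -> (0 : R) = 0 ->
  (0 : R) - 0 != 1 by rewrite subr0 eq_sym oner_eq0.
move=> /(_ h1 h2); apply: negligibleS => w /= nN gp; apply: nN.
apply: general_position_ext gp => j jn.
by rewrite scale0r subr0 (@tuple_path_walk R T (fun i => X i)).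
Qed.

(** The [k (n + 1 - k)] events have probability at most [c] each and 1 together, which is also the
    sum of the bounds; hence every bound is attained. *)
Lemma conditional_bridge_lowest (R : realType) (d : measure_display)
    (T : measurableType d) (P : probability T R)
    (X : nat -> {RV P >-> (R * R)%type}) (n k : nat)
    (Q : probability (n.-tuple (R * R)%type) R) :
  iid X ->
  (forall h : set (R * R), affine_line h -> P (X 0%N @^-1` h) = 0%E) ->
  conditional_bridge_law X Q -> (0 < k < n.+1)%N ->
  Q [set t | lowest 0 n.+1 k 0 k (tuple_path t)] =
  (1 / (k * (n.+1 - k))%:R)%:E.
Proof.
move=> iidX hline QP km.
pose c : R := 1 / (k * (n.+1 - k))%:R.
pose E (i : 'I_k * 'I_(n.+1 - k)) := [set t : n.-tuple (R * R) |
  lowest 0 n.+1 k i.1 (k + i.2) (tuple_path t)].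
have mE i : measurable (E i).
  by case: i => [[i ik] [j jk]]; apply: measurable_lowest_tuple_path => /=; lia.
have QE i : Q (E i) \is a fin_num by exact: fin_num_measure.
have sumc : \sum_(i : 'I_k * 'I_(n.+1 - k)) c = 1.
  rewrite sumr_const card_prod !card_ord -[LHS]mulr_natr /c mul1r mulVf//.
  by rewrite pnatr_eq0 muln_eq0; lia.
have sumQ : (\sum_i Q (E i) = 1)%E.
  rewrite -(probability_setT Q) (lowest_partition (mu := Q) km measurableT
    (s := fun t => tuple_path t)).
  - by apply: eq_bigr => i _; rewrite setIT.
  - by move=> j jn; exact: measurable_tuple_path.
  - exact: conditional_bridge_general_position iidX hline QP.
have Qle i : fine (Q (E i)) <= c.
  rewrite -lee_fin fineK//; case: i => [[i ik] [j jk]].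
  by apply: (conditional_bridge_lowest_le iidX hline QP) => /=; lia.
have : \sum_i (c - fine (Q (E i))) = 0.
  rewrite sumrB sumc; apply/eqP; rewrite subr_eq0 -eqe -sumQ -sumEFin.
  by apply/eqP; apply: eq_bigr => i _; rewrite fineK.
move/eqP; rewrite psumr_eq0 => [/allP h|i _]; last by rewrite subr_ge0.
have k0 : (0 < k)%N by lia.
have nk0 : (0 < n.+1 - k)%N by lia.
(* The position sought is the pair of 0 and [k], with offset 0 in the second block. *)
have := h (Ordinal k0, Ordinal nk0) (mem_index_enum _).
rewrite /= subr_eq0 => /eqP; rewrite -/c => ->.
by rewrite fineK//; congr (Q _); apply/seteqP; split => t; rewrite /E /= addn0.
Qed.

Theorem theorem3 (R : realType) (d : measure_display) (T : measurableType d)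
    (P : probability T R) (X : nat -> {RV P >-> (R * R)%type}) (n : nat)
    (hn : (2 <= n)%N) (hX : iid X)
    (hline : forall h : set (R * R), affine_line h -> P (X 0%N @^-1` h) = 0%E) :
  P [set w | ~ conv_hull
       [set difference_bridge X n k w | k in [set k : nat | (1 <= k <= n)%N]] 0]
  = (\sum_(1 <= k < n.+1) 1 / (k * (n - k + 1))%:R)%:E
  /\
  forall Q : probability (n.-tuple (R * R)%type) R,
    conditional_bridge_law X Q ->
    Q [set s | ~ conv_hull (range (tnth s)) 0]
    = (\sum_(1 <= k < n.+1) 1 / (k * (n - k + 1))%:R)%:E.
Proof.
split=> [|Q QP]; first exact: difference_bridge_probability.
under eq_set do rewrite range_tnth.
rewrite (@conv_hull0_probability _ _ _ Q (fun t => tuple_path t))//.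
- rewrite -bridge_sumE; apply: eq_bigr => -[i ni] _ /=.
  exact: conditional_bridge_lowest hX hline QP _.
- by move=> j jn; exact: measurable_tuple_path.
- exact: conditional_bridge_general_position hX hline QP.
Qed.
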